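(* Let $\omega_1,\omega_2,\omega_3\in\mathbb{Z}_{\ge2}\cup\{\infty\}$ with (at least) one $\omega_i$ finite, and fix either the Campana or the Darmon notion of semi-integral points. For real $B\ge1$ let \[ N(B)=\#\{m\in\mathbb{Z}\setminus\{0,4\} : |m|\le B,\ \mathcal{U}_m(\mathbb{A}_{\mathbb{Z}})=\emptyset \text{ but } (\mathcal{X}_m,\mathcal{D}_{\underline\omega})^*_{\mathrm{str}}(\mathbb{Z})\ne\emptyset\}. \] Then $N(B)\gg B/(\log B)^{1/2}$, i.e. there are constants $c>0$, $B_0$ with $N(B)\ge cB/(\log B)^{1/2}$ for all $B\ge B_0$.
   Context: For $m\in\mathbb{Z}\setminus\{0,4\}$: $U_m\subset\mathbb{A}^3_{\mathbb{Q}}$ is $u_1^2+u_2^2+u_3^2-u_1u_2u_3=m$, with $\mathbb{Z}$-model $\mathcal{U}_m$ given by the same equation, and $\mathcal{U}_m(\mathbb{A}_{\mathbb{Z}})=U_m(\mathbb{R})\times\prod_p\mathcal{U}_m(\mathbb{Z}_p)$. $X_m\subset\mathbb{P}^3_{\mathbb{Q}}$ is $x_0(x_1^2+x_2^2+x_3^2)-x_1x_2x_3=mx_0^3$ with $\mathbb{Z}$-model $\mathcal{X}_m$ given by the same equation, $U_m=X_m\cap\{x_0\ne0\}$ via $u_i=x_i/x_0$. Boundary components $D_i=\{x_0=x_i=0\}$ with closures $\mathcal{D}_i$ in $\mathcal{X}_m$; $\mathcal{D}_{\underline\omega}=\sum_i(1-1/\omega_i)\mathcal{D}_i$; $\mathcal{D}_{\inf}=\bigcup_{\omega_i=\infty}\mathcal{D}_i$.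 For a prime $p$ and $M_p\in\mathcal{X}_m(\mathbb{Z}_p)$ (the unique extension of a point of $X_m(\mathbb{Q}_p)$), write $\mathrm{Spec}\,\mathbb{Z}_p\times_{\mathcal{X}_m}\mathcal{D}_i=\mathrm{Spec}(\mathbb{Z}_p/I)$ and $n_p(\mathcal{D}_i,M_p)=\infty$ if $I=0$, $=n$ if $I=(p^n)$. A point $M\in X_m(\mathbb{Q})$ is a (global) semi-integral point if $M\notin D_i$ for all $i$ with $\omega_i=\infty$ and, for every prime $p$, $M_p\in(\mathcal{X}_m\setminus\mathcal{D}_{\inf})(\mathbb{Z}_p)$ and for every $i$ with $\omega_i<\infty$, $n_p(\mathcal{D}_i,M_p)\in\mathbb{Z}_{\ge\omega_i}\cup\{0,\infty\}$ (Campana points) resp. $n_p(\mathcal{D}_i,M_p)\in\omega_i\mathbb{Z}_{\ge0}\cup\{\infty\}$ (Darmon points). $(\mathcal{X}_m,\mathcal{D}_{\underline\omega})^*_{\mathrm{str}}(\mathbb{Z})$ is the set of such points lying in $U_m(\mathbb{Q})$. *)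

(* Defs.v *)
From HB Require Import structures.
From mathcomp Require Import all_boot all_order all_algebra finmap.
From mathcomp Require Import all_classical all_reals all_analysis.
From mathcomp Require Import zify.
Set Implicit Arguments.
Unset Strict Implicit.
Unset Printing Implicit Defensive.
Import Order.TTheory GRing.Theory Num.Theory.
Local Open Scope classical_set_scope.
Local Open Scope ring_scope.

Record primeNat := PrimeNat { prime_val :> nat; primeNatP : prime prime_val }.

(* Z_p, as the inverse limit of the rings Z/p^(n+1). *)
Section PadicInt.
Variable p : primeNat.

Definition Zpn (n : nat) := 'Z_(p ^ n.+1).

Definition Zpn_red (n : nat) (a : Zpn n.+1) : Zpn n := (a : nat)%:R.

Record padicInt := PadicInt {
  pres :> forall n, Zpn n;
  pres_compat : forall n, Zpn_red (pres n.+1) = pres n }.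

Lemma expp_gt1 n : (1 < p ^ n.+1)%N.
Proof.
by rewrite -{1}(exp1n n.+1) ltn_exp2r // prime_gt1 // primeNatP.
Qed.

Lemma natr_dvd_mod q r k : (1 < q)%N -> (q %| r)%N -> (k %% r)%:R = k%:R :> 'Z_q.
Proof.
by move=> q1 qr; rewrite -(Zp_nat_mod q1 (k %% r)) modn_dvdm // Zp_nat_mod.
Qed.

Lemma Zpn_valD n (a b : Zpn n) : (a + b : Zpn n) = ((a + b)%N %% p ^ n.+1)%N :> nat.
Proof. by apply: (congr1 (modn _)); rewrite Zp_cast // expp_gt1. Qed.

Lemma Zpn_valM n (a b : Zpn n) : (a * b : Zpn n) = ((a * b)%N %% p ^ n.+1)%N :> nat.
Proof. by apply: (congr1 (modn _)); rewrite Zp_cast // expp_gt1. Qed.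

Lemma Zpn_red_zmod n : zmod_morphism (@Zpn_red n).
Proof.
have D (a b : Zpn n.+1) : Zpn_red (a + b) = Zpn_red a + Zpn_red b.
  rewrite /Zpn_red Zpn_valD natr_dvd_mod ?natrD ?expp_gt1 //.
  exact: dvdn_exp2l.
by move=> a b; have := D (a - b) b; rewrite subrK => ->; rewrite addrK.
Qed.

Lemma Zpn_red_monoid n : monoid_morphism (@Zpn_red n).
Proof.
split=> [|a b].
  by rewrite /Zpn_red /= modn_small.
rewrite /Zpn_red Zpn_valM natr_dvd_mod ?natrM ?expp_gt1 //.
exact: dvdn_exp2l.
Qed.

HB.instance Definition _ n :=
  GRing.isZmodMorphism.Build (Zpn n.+1) (Zpn n) (@Zpn_red n) (@Zpn_red_zmod n).
HB.instance Definition _ n :=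
  GRing.isMonoidMorphism.Build (Zpn n.+1) (Zpn n) (@Zpn_red n) (@Zpn_red_monoid n).

Lemma padicInt_eq (x y : padicInt) : (forall n, x n = y n) -> x = y.
Proof.
case: x y => [x hx] [y hy] /= exy.
have e : x = y by exact: functional_extensionality_dep.
by case: _ / e hy => hy; congr PadicInt; exact: Prop_irrelevance.
Qed.

HB.instance Definition _ := gen_eqMixin padicInt.
HB.instance Definition _ := gen_choiceMixin padicInt.

Definition padic0 : padicInt.
Proof. by exists (fun n => 0) => n; exact: rmorph0. Defined.

Definition padic1 : padicInt.
Proof. by exists (fun n => 1) => n; exact: rmorph1. Defined.

Definition padic_opp (x : padicInt) : padicInt.
Proof. by exists (fun n => - x n) => n; rewrite rmorphN /= pres_compat. Defined.

Definition padic_add (x y : padicInt) : padicInt.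
Proof. by exists (fun n => x n + y n) => n; rewrite rmorphD /= !pres_compat. Defined.

Definition padic_mul (x y : padicInt) : padicInt.
Proof. by exists (fun n => x n * y n) => n; rewrite rmorphM /= !pres_compat. Defined.

Lemma padic_addA : associative padic_add.
Proof. by move=> x y z; apply: padicInt_eq => n /=; rewrite addrA. Qed.
Lemma padic_addC : commutative padic_add.
Proof. by move=> x y; apply: padicInt_eq => n /=; rewrite addrC. Qed.
Lemma padic_add0 : left_id padic0 padic_add.
Proof. by move=> x; apply: padicInt_eq => n /=; rewrite add0r. Qed.
Lemma padic_addN : left_inverse padic0 padic_opp padic_add.
Proof. by move=> x; apply: padicInt_eq => n /=; rewrite addNr. Qed.
HB.instance Definition _ :=
  GRing.isZmodule.Build padicInt padic_addA padic_addC padic_add0 padic_addN.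

Lemma padic_mulA : associative padic_mul.
Proof. by move=> x y z; apply: padicInt_eq => n /=; rewrite mulrA. Qed.
Lemma padic_mulC : commutative padic_mul.
Proof. by move=> x y; apply: padicInt_eq => n /=; rewrite mulrC. Qed.
Lemma padic_mul1 : left_id padic1 padic_mul.
Proof. by move=> x; apply: padicInt_eq => n /=; rewrite mul1r. Qed.
Lemma padic_mulDl : left_distributive padic_mul padic_add.
Proof. by move=> x y z; apply: padicInt_eq => n /=; rewrite mulrDl. Qed.
Lemma padic_1_neq0 : padic1 != padic0.
Proof.
apply/eqP => /(congr1 (fun x : padicInt => x 0%N)) /= /eqP.
by rewrite oner_eq0.
Qed.
HB.instance Definition _ := GRing.Zmodule_isComNzRing.Build padicInt
  padic_mulA padic_mulC padic_mul1 padic_mulDl padic_1_neq0.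

Definition padic_unit : pred padicInt := fun x => `[< exists y, y * x = 1 >].
Definition padic_inv (x : padicInt) : padicInt := xget x [set y | y * x = 1].

Lemma padic_mulV : {in padic_unit, left_inverse 1 padic_inv *%R}.
Proof.
move=> x /asboolP [y yx]; rewrite /padic_inv.
by case: xgetP => [z _ /= //|/(_ y)].
Qed.
Lemma padic_unitP (x y : padicInt) : y * x = 1 -> padic_unit x.
Proof. by move=> yx; apply/asboolP; exists y. Qed.
Lemma padic_inv_out : {in [predC padic_unit], padic_inv =1 id}.
Proof.
move=> x; rewrite inE => /asboolP nx; rewrite /padic_inv.
by case: xgetP => [z _ /= zx|//]; case: nx; exists z.
Qed.
HB.instance Definition _ := GRing.ComNzRing_hasMulInverse.Build padicInt
  padic_mulV padic_unitP padic_inv_out.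

Lemma padic_mod (x : padicInt) k l :
  (x (k + l) %% p ^ k.+1)%N = x k :> nat.
Proof.
elim: l => [|l IH].
  by rewrite addn0 modn_small // -[X in (_ < X)%N]Zp_cast ?expp_gt1.
rewrite addnS -IH -(pres_compat x (k + l)) /Zpn_red.
rewrite val_Zp_nat ?expp_gt1 // modn_dvdm //.
by apply: dvdn_exp2l; rewrite ltnS leq_addr.
Qed.

Lemma padic_neq0 (x : padicInt) : x != 0 ->
  exists k, forall l, ~~ (p ^ k.+1 %| x (k + l))%N.
Proof.
move=> /eqP x0; apply: contrapT => H; apply: x0; apply: padicInt_eq => n.
apply/val_inj => /=; apply/eqP; apply: contrapT => /negP xn.
by apply: H; exists n => l; rewrite /dvdn padic_mod.
Qed.

Lemma padic_integral (x y : padicInt) : x * y = 0 -> (x == 0) || (y == 0).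
Proof.
move=> xy; apply: contraT => /norP [/padic_neq0 [k hk] /padic_neq0 [l hl]].
have {hk} := hk l.+1; have {hl} := hl k.+1.
rewrite (_ : (l + k.+1)%N = (k + l.+1)%N); last by rewrite !addnS addnC.
set n := (k + l.+1)%N; set a := (x n : nat); set b := (y n : nat) => hb ha.
have pp := primeNatP p.
have a0 : (0 < a)%N by case: (posnP a) ha => // ->; rewrite dvdn0.
have b0 : (0 < b)%N by case: (posnP b) hb => // ->; rewrite dvdn0.
move: ha hb; rewrite !pfactor_dvdn // -!ltnNge !ltnS => ha hb.
have /(congr1 (fun z : padicInt => (z n : nat))) := xy.
rewrite [LHS](Zpn_valM (x n) (y n)) /= => /eqP.
rewrite -/(dvdn _ _) -/a -/b pfactor_dvdn ?muln_gt0 ?a0 // lognM // leqNgt.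
by rewrite ltnS (leq_trans (leq_add ha hb)) // /n leq_add2l.
Qed.
HB.instance Definition _ :=
  GRing.ComUnitRing_isIntegral.Build padicInt padic_integral.

End PadicInt.

Section Surfaces.
Variables (A : comNzRingType) (m : int).

(* u_1, u_2, u_3 are u 0, u 1, u 2. *)
Definition Upts : set ('I_3 -> A) :=
  [set u | \sum_(i < 3) u i ^+ 2 - \prod_(i < 3) u i = m%:~R].

(* x_0 is x ord0, and x_1, x_2, x_3 are x (lift ord0 i) for i = 0, 1, 2. *)
Definition Xeq (x : 'I_4 -> A) : Prop :=
  x ord0 * (\sum_(i < 3) x (lift ord0 i) ^+ 2) - \prod_(i < 3) x (lift ord0 i)
  = m%:~R * x ord0 ^+ 3.

End Surfaces.

(* U_m(A_Z) = U_m(R) x prod_p U_m(Z_p) *)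
Definition Uadelic (R : realType) (m : int) :
    set (('I_3 -> R) * (forall p : primeNat, 'I_3 -> padicInt p)) :=
  [set v | Upts m v.1 /\ forall p : primeNat, Upts m (v.2 p)].

(* Homogeneous coordinates of points of X_m(Q). *)
Definition Xrat (m : int) : set ('I_4 -> rat) :=
  [set x | (exists j, x j != 0) /\ Xeq m x].

Section Local.
Variable p : primeNat.

(* As Z_p is local, its points on a closed subscheme of P^3 are the quadruples
   with a unit coordinate satisfying the equations, up to units. *)
Definition Xpadic (m : int) : set ('I_4 -> padicInt p) :=
  [set y | (exists j, y j \is a GRing.unit) /\ Xeq m y].

(* [y] and [x] are the same point of P^3(Q_p). *)
Definition extends (x : 'I_4 -> rat) (y : 'I_4 -> padicInt p) : Prop :=
  exists2 l : {fraction padicInt p}, l != 0 & forall j, FracField.tofrac (y j) = l * ratr (x j).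

(* The ideal I with Spec Z_p x_X D_i = Spec (Z_p / I): the closure of D_i in the
   integral model is the relative line x_0 = x_i = 0, so I = (y_0, y_i). *)
Definition bdIdeal (y : 'I_4 -> padicInt p) (i : 'I_3) : set (padicInt p) :=
  [set z | exists a b, z = a * y ord0 + b * y (lift ord0 i)].

Definition pIdeal (n : nat) : set (padicInt p) :=
  [set z | exists a, z = a * (p : nat)%:R ^+ n].

(* n_p(D_i, y) = e, where [None] stands for infinity. *)
Definition intMult (y : 'I_4 -> padicInt p) (i : 'I_3) (e : option nat) : Prop :=
  match e with
  | None => bdIdeal y i = [set 0]
  | Some n => bdIdeal y i = pIdeal n
  end.

End Local.

Inductive semiIntKind := Campana | Darmon.

Definition allowedMult (k : semiIntKind) (w : nat) (e : option nat) : Prop :=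
  match e, k with
  | None, _ => True
  | Some n, Campana => n = 0%N \/ (w <= n)%N
  | Some n, Darmon => (w %| n)%N
  end.

(* The weight omega_(i+1) is [w i], where [None] stands for infinity. *)
Definition weights := 'I_3 -> option nat.

(* The condition at p on the extension [y] of a rational point. For
   omega_i = infinity, y avoids D_i iff the fibre product is empty, i.e. I = Z_p. *)
Definition semiIntAt (k : semiIntKind) (w : weights) (p : primeNat)
    (y : 'I_4 -> padicInt p) : Prop :=
  forall i, match w i with
            | None => bdIdeal y i = [set: padicInt p]
            | Some wi => exists2 e, intMult y i e & allowedMult k wi e
            end.

Definition semiInt (k : semiIntKind) (w : weights) (m : int) : set ('I_4 -> rat) :=
  [set x | [/\ Xrat m x,
     forall i, w i = None -> ~ (x ord0 = 0 /\ x (lift ord0 i) = 0) &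
     forall p : primeNat,
       exists y : 'I_4 -> padicInt p, [/\ Xpadic m y, extends x y & semiIntAt k w y]]].

(* (u_1, u_2, u_3) |-> [1 : u_1 : u_2 : u_3] *)
Definition affineEmb (u : 'I_3 -> rat) : 'I_4 -> rat :=
  fun j => if unlift ord0 j is Some i then u i else 1.

Definition strSemiInt (k : semiIntKind) (w : weights) (m : int) : set ('I_3 -> rat) :=
  [set u | Upts m u /\ semiInt k w m (affineEmb u)].

Definition countedM (R : realType) (k : semiIntKind) (w : weights) (B : R) : set int :=
  [set m : int | [/\ m != 0 /\ m != 4, `|m%:~R| <= B,
               @Uadelic R m = set0 & strSemiInt k w m !=set0]].

Lemma finite_countedM (R : realType) k w (B : R) : finite_set (countedM k w B).
Proof.
have [B0|B0] := ltP B 0.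
  rewrite (_ : countedM k w B = set0); first exact: finite_set0.
  by rewrite -subset0 => m [_ /(le_lt_trans)/(_ B0)]; rewrite ltNge normr_ge0.
pose N := Num.truncn B.
pose s := [seq (i%:Z - N%:Z)%R | i <- iota 0 (2 * N).+1].
apply: (@sub_finite_set _ _ [set` s]) => [m [_ mB _ _]|].
  change (m \in s).
  have mN : (`|m| <= N)%N.
    rewrite /N truncn_ge_nat // natr_absz intr_norm //.
  apply/mapP; exists (`|(m + N%:Z)%R|%N); last first.
    by rewrite gez0_abs ?addrK //; lia.
  by rewrite mem_iota; lia.
exact: finite_seq.
Qed.

Definition countN (R : realType) (k : semiIntKind) (w : weights) (B : R) : nat :=
  #|` fset_set (countedM k w B)|%fset.

(* Main.v *)
From HB Require Import structures.
Require Import Defs.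
From mathcomp Require Import all_boot all_order all_algebra all_fingroup all_solvable all_field finmap.
From mathcomp Require Import all_classical all_reals all_analysis.
From mathcomp Require Import zify ring lra.
Set Implicit Arguments.
Unset Strict Implicit.
Unset Printing Implicit Defensive.
Import Order.TTheory GRing.Theory Num.Theory.
Local Open Scope ring_scope.

(** If [m = 3] or [6] modulo 9, then [U_m] has no point over Z_3.  Choose an
    index [i] with finite weight [w].  A point with [u_i = 11] and the other
    coordinates [x / 3^w], [y / 3^w], where [x] and [y] are prime to 3, meets
    only [D_i], only at 3, and with multiplicity exactly [w], so it is both a
    Campana and a Darmon point.  It lies on [U_m] for [m = 121 + n] when
    [x^2 - 11 x y + y^2 = n 9^w].  This form has discriminant [9 * 13], and the
    equation is solvable as soon as [n] is prime to 3 and a norm from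
    Z[omega], [omega^2 = omega + 3], the ring of integers of Q(sqrt 13), in
    which [omega] has norm -3 and [1 + omega] has norm -1.  Every product of
    primes that split in Q(sqrt 13), other than 3, is such a norm: the Gauss
    period of conductor 13 gives a root of [X^2 + X - 3] modulo a split prime,
    and Thue's lemma together with descent represents the prime.  Multiplying
    by -1 or 4 puts [m] in a class 3 or 6 modulo 9.

    It remains to show that the products [n <= N] of such primes ("good" [n])
    number at least [c N / sqrt (ln N)].  Chebyshev's and Mertens' estimates
    and [L(1, chi) > 0] show that the good primes have Dirichlet density 1/2,
    whence [sum_(p^k <= M good) ln p >= c M].  Comparing
    [sum_(n <= N) (1 * chi)(n) / n], which is at least [ln N / 4 - 4], with the
    square of [F(N) = sum_(n <= N good) 1 / n] gives [F(N) >= c sqrt (ln N)].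
    Finally, [sum_(n <= N good) ln n], expanded by means of the von Mangoldt
    function, is at least [c N F(N / M0)]. *)

(** * Norms from Q(sqrt 13) *)

(* The quadratic character modulo 13, set to 0 on the multiples of 3. *)
Definition chi (n : nat) : int :=
  if (3 %| n)%N || (13 %| n)%N then 0
  else if (n %% 13)%N \in [:: 1; 3; 4; 9; 10; 12]%N then 1 else -1.

Lemma chi_mod n : chi n = chi (n %% 39).
Proof.
rewrite /chi modn_dvdm // /dvdn !modn_dvdm //.
Qed.

Lemma chi_modM a b : (a < 39)%N -> (b < 39)%N -> chi (a * b) = chi a * chi b.
Proof.
have H : all (fun a => all (fun b => chi (a * b) == chi a * chi b) (iota 0 39)) (iota 0 39).
  by vm_compute.
move=> ha hb; move/allP: H => /(_ a); rewrite mem_iota => /(_ ha)/allP/(_ b).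
by rewrite mem_iota => /(_ hb)/eqP.
Qed.

Lemma chiM a b : chi (a * b) = chi a * chi b.
Proof.
rewrite chi_mod -modnMml -modnMmr -chi_mod (chi_mod a) (chi_mod b).
by apply: chi_modM; rewrite ltn_mod.
Qed.

Lemma chiX a n : chi (a ^ n) = chi a ^+ n.
Proof. by elim: n => [|n IH]; rewrite ?expn0 // expnS chiM IH exprS. Qed.

(* The norm of [x + y * omega], where [omega ^ 2 = omega + 3]. *)
Definition qnorm (x y : int) : int := x ^+ 2 + x * y - 3 * y ^+ 2.

Lemma qnormM a b c d :
  qnorm a b * qnorm c d = qnorm (a * c + 3 * (b * d)) (a * d + b * c + b * d).
Proof. by rewrite /qnorm; ring. Qed.

Lemma qnorm_opp (n x y : int) : qnorm x y = n -> exists x' y', qnorm x' y' = - n.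
Proof.
move=> <-; exists (x + 3 * y), (x + 2 * y); rewrite /qnorm; ring.
Qed.

(** The exponents are the nonzero squares modulo 13, so [e] is a Gauss period. It satisfies the
    equation of an integral generator of Q(sqrt 13). *)
Lemma gauss_period_root (L : comNzRingType) (z : L) :
  \sum_(i < 13) z ^+ i = 0 ->
  let e := z + z ^+ 3 + z ^+ 4 + z ^+ 9 + z ^+ 10 + z ^+ 12 in
  e ^+ 2 + e - 3%:R = 0.
Proof.
(* The long factor is the quotient of [e ^+ 2 + e - 3], as a polynomial in [z], by
   [1 + z + ... + z ^+ 12]. *)
move=> H e; rewrite -[RHS](mulr0 (z ^+ 12 - z ^+ 11 + 2%:R * z ^+ 10 - z ^+ 8 +
  z ^+ 7 - z ^+ 6 - z ^+ 5 + 2%:R * z ^+ 4 + 4%:R * z - 3%:R)) -H.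
by rewrite !big_ord_recl big_ord0 /= /bump /= /e; ring.
Qed.

Lemma dvdz_pcharf (L : nzRingType) p (z : int) :
  p \in [pchar L] -> (p%:Z %| z)%Z = (z%:~R == 0 :> L).
Proof.
move=> chL; case: z => n; rewrite dvdzE.
  by rewrite -pmulrn -(dvdn_pcharf chL).
by rewrite NegzE abszN rmorphN /= -pmulrn oppr_eq0 -(dvdn_pcharf chL).
Qed.

(** The [p] elements of the prime field are already roots of [X^p - X]; a further fixed point would
    be one root too many. *)
Lemma Frobenius_fixed_nat (L : fieldType) p (z : L) :
  p \in [pchar L] -> z ^+ p = z -> exists k : nat, z = k%:R.
Proof.
move=> chL zp; have p_pr := pcharf_prime chL; have p_gt1 := prime_gt1 p_pr.
pose rs : seq L := [seq k%:R | k <- iota 0 p].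
have [/mapP[k _ ->]|zn] := boolP (z \in rs); first by exists k.
pose P : {poly L} := 'X^p - 'X.
have sP : size P = p.+1 by rewrite size_polyDl size_polyXn // size_polyN size_polyX.
have P0 : P != 0 by rewrite -size_poly_eq0 sP.
have inj : {in iota 0 p &, injective (fun k : nat => k%:R : L)}.
  have aux i j : (i <= j)%N -> (j < p)%N -> i%:R = j%:R :> L -> i = j.
    move=> ij jp eij; have : (p %| j - i)%N.
      by rewrite (dvdn_pcharf chL) natrB // eij subrr.
    by case: (posnP (j - i)%N) => [|h /(dvdn_leq h)]; lia.
  move=> i j; rewrite !mem_iota /= !add0n => ip jp eij.
  have [ij|/ltnW ij] := leqP i j; first exact: aux.
  by apply/esym; apply: aux.
have U : uniq (z :: rs) by rewrite /= zn map_inj_in_uniq ?iota_uniq.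
have rt : all (root P) (z :: rs).
  rewrite /= /root !hornerE zp subrr eqxx /=.
  apply/allP => _ /mapP[k _ ->]; rewrite /root !hornerE subr_eq0.
  by rewrite -(pFrobenius_autE chL) rmorph_nat.
by have := max_poly_roots P0 rt U; rewrite sP /= size_map size_iota ltnn.
Qed.

(** By Fermat, 13 divides [p ^ 12 - 1], the order of the unit group of the field with [p ^ 12]
    elements, and Cauchy's theorem gives a unit of order 13. *)
Lemma exists_root13 p : prime p -> p != 13%N ->
  exists (L : finFieldType) (z : L),
    [/\ p \in [pchar L], z ^+ 13 = 1 & \sum_(i < 13) z ^+ i = 0].
Proof.
move=> p_pr p13; have [L chL cL] := pPrimePowerField p_pr (isT : (0 < 12)%N).
have d13 : (13 %| #|[set: {unit L}]|)%N.
  rewrite card_finField_unit cL -subn1 -eqn_mod_dvd ?expn_gt0 ?prime_gt0 //.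
  have cop : coprime p 13 by rewrite prime_coprime // dvdn_prime2.
  by have := Euler_exp_totient cop; rewrite totient_prime // => ->.
have [u _ ou] := Cauchy (isT : prime 13) d13.
exists L, (val u); split=> //.
  by rewrite -FinRing.val_unitX -ou expg_order.
have z1 : val u - 1 != 0.
  rewrite subr_eq0; apply/eqP => e; have e1 : u = 1%g by apply: val_inj.
  by move: ou; rewrite e1 order1.
apply: (mulfI z1); rewrite mulr0 -subrX1 -FinRing.val_unitX -ou expg_order.
by rewrite /= subrr.
Qed.

(** Multiplication by a square permutes the squares modulo 13, so Frobenius fixes the Gauss period,
    which therefore lies in the prime field. Any [k] lifting it works, as [qnorm k 1] is
    [k ^ 2 + k - 3]. *)
Lemma chi_prime_root p : prime p -> chi p = 1 -> exists k : nat, (p%:Z %| qnorm k 1)%Z.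
Proof.
move=> p_pr; rewrite /chi; case: ifP => // /negbT/norP[_ p13].
case: ifP => // pm _.
have p13' : p != 13%N by apply: contraNneq p13 => ->.
have [L [z [chL z13 zs]]] := exists_root13 p_pr p13'.
have zm n : z ^+ n = z ^+ (n %% 13).
  by rewrite {1}(divn_eq n 13) exprD mulnC exprM z13 expr1n mul1r.
set e := z + z ^+ 3 + z ^+ 4 + z ^+ 9 + z ^+ 10 + z ^+ 12.
have ep : e ^+ p = e.
  rewrite -(pFrobenius_autE chL) !rmorphD !rmorphXn /= !pFrobenius_autE -!exprM.
  rewrite [z ^+ p]zm (zm (p * 3)%N) (zm (p * 4)%N) (zm (p * 9)%N) (zm (p * 10)%N) (zm (p * 12)%N).
  rewrite -(modnMml p 3) -(modnMml p 4) -(modnMml p 9) -(modnMml p 10) -(modnMml p 12).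
  move: pm; rewrite /e !inE => /or4P[/eqP->|/eqP->|/eqP->|/or3P[/eqP->|/eqP->|/eqP->]] /=;
    rewrite ?expr1; ring.
have [k ek] := Frobenius_fixed_nat chL ep; exists k.
have := gauss_period_root zs; rewrite -/e ek /= => H.
have : (k ^ 2 + k)%:R = 3%:R :> L.
  by apply/eqP; rewrite -subr_eq0 natrD natrX H.
move=> H2; have -> : qnorm k 1 = (k ^ 2 + k)%:Z - 3 by rewrite /qnorm -mulnn; lia.
by rewrite (dvdz_pcharf _ chL) rmorphB /= -!pmulrn H2 subrr.
Qed.

(** The equation becomes [(2x + y)^2 = 13 y^2], where the 13-adic valuations have opposite parities
    unless [y = 0]. *)
Lemma qnorm_eq0 x y : qnorm x y = 0 -> y = 0.
Proof.
rewrite /qnorm => H; have {H} : ((2 * x + y) ^+ 2 = 13 * y ^+ 2)%R by lia.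
have [//|y0] := eqVneq y 0 => H.
have {}H : (`|(2 * x + y)%R| ^ 2 = 13 * `|y| ^ 2)%N.
  by rewrite -!abszX H abszM.
have y1 : (0 < `|y|)%N by rewrite absz_gt0.
have := congr1 (logn 13) H; rewrite lognX lognM ?expn_gt0 ?y1 // lognX (_ : logn 13 13 = 1%N) //=.
by lia.
Qed.

Lemma exists_sqrtn n : exists s : nat, (s ^ 2 <= n < s.+1 ^ 2)%N.
Proof.
elim: n => [|n [s /andP[h1 h2]]]; first by exists 0%N.
have [h|h] := ltnP n.+1 (s.+1 ^ 2); first by exists s; rewrite h leqW.
by exists s.+1; rewrite h /=; lia.
Qed.

(** Thue's lemma: there are more than [p] pairs with entries between 0 and the integer square root
    of [p], so two of them have the same [a - k b] modulo [p]. *)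
Lemma thue_pigeonhole p (k : nat) : prime p -> exists x y : int,
  [/\ (x != 0) || (y != 0), x ^+ 2 < p%:Z, y ^+ 2 < p%:Z & (p%:Z %| x - k%:Z * y)%Z].
Proof.
move=> p_pr; have p_gt0 := prime_gt0 p_pr.
have [s /andP[s1 s2]] := exists_sqrtn p.
have {}s1 : (s ^ 2 < p)%N.
  rewrite ltn_neqAle s1 andbT; apply/eqP => sp.
  have s_gt1 : (1 < s)%N by have := prime_gt1 p_pr; rewrite -sp; case: (s) => [|[|]].
  by have := primeP p_pr => -[_ /(_ s)]; rewrite -sp dvdn_mulr // => /(_ isT); nia.
(* The factor [k * p.-1] stands for [- k] modulo [p] and keeps the expression in the natural
   numbers. *)
pose f (ab : 'I_s.+1 * 'I_s.+1) : 'I_p :=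
  Ordinal (ltn_pmod (ab.1 + k * p.-1 * ab.2)%N p_gt0).
have /injectivePn[[a b] [[a' b'] ne eqf]] : ~~ injectiveb f.
  apply/negP => /injectiveP/leq_card; rewrite card_prod !card_ord leqNgt.
  by rewrite mulnn s2.
have {eqf} := congr1 (fun i : 'I_p => nat_of_ord i) eqf; rewrite /f /= => /eqP.
rewrite -(eqz_nat) -!modz_nat eqz_mod_dvd !PoszD !PoszM => dv.
exists (a%:Z - a'%:Z), (b%:Z - b'%:Z).
have ha := ltn_ord a; have hb := ltn_ord b.
have ha' := ltn_ord a'; have hb' := ltn_ord b'.
split; first 1 last.
- by nia.
- by nia.
- have -> : a%:Z - a'%:Z - k%:Z * (b%:Z - b'%:Z) =
     (a%:Z + k%:Z * p.-1%:Z * b%:Z - (a'%:Z + k%:Z * p.-1%:Z * b'%:Z)) +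
     (- k%:Z * (b%:Z - b'%:Z)) * p%:Z.
    have -> : p%:Z = p.-1%:Z + 1 by lia.
    ring.
  by rewrite rpredD // dvdz_mull.
apply: contraNT ne; rewrite negb_or !negbK !subr_eq0 !eqz_nat => /andP[h1 h2].
by rewrite xpair_eqE -!val_eqE /= h1 h2.
Qed.

Lemma int_mod2 (x : int) : exists a : int, x = 2 * a \/ x = 2 * a + 1.
Proof. by exists (x %/ 2)%Z; lia. Qed.

Lemma int_mod3 (x : int) :
  exists a : int, x = 3 * a \/ x = 3 * a + 1 \/ x = 3 * a + 2.
Proof. by exists (x %/ 3)%Z; lia. Qed.

(** Modulo 3 the form is [x (x + y)]. If 3 divides [x], the element is divisible by omega, otherwise
    by its conjugate; both have norm -3. *)
Lemma qnorm_div3 x y n : qnorm x y = - 3 * n -> exists x' y', qnorm x' y' = n.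
Proof.
rewrite /qnorm => H.
have [[z xz]|[z xz]] : (exists z, x = 3 * z) \/ (exists z, x = 3 * z - y).
- have [a ha] := int_mod3 x; have [b hb] := int_mod3 y.
  case: ha H => [->|[->|->]]; first by left; exists a.
    by case: hb => [->|[->|->]] H;
      [exfalso; lia|exfalso; lia|right; exists (a + b + 1); lia].
  by case: hb => [->|[->|->]] H;
    [exfalso; lia|right; exists (a + b + 1); lia|exfalso; lia].
- by exists (y - z), z; move: H; rewrite xz; lia.
- exists y, z; move: H; rewrite xz; lia.
Qed.

(** The prime 2 is inert: an even value forces [x] and [y] to be even, so the value is divisible by
    4. *)
Lemma qnorm_even x y n : qnorm x y = - 2 * n -> exists z, n = 2 * z.
Proof.
rewrite /qnorm; have [a [|] ->] := int_mod2 x; have [b [|] ->] := int_mod2 y => H.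
- by exists (- a ^+ 2 - a * b + 3 * b ^+ 2); lia.
- by exfalso; lia.
- by exfalso; lia.
- by exfalso; lia.
Qed.

(** Thue's lemma gives a nonzero multiple [j p] of norm form with [-3 <= j <= 1]. The case -1 is
    repaired by a unit and -3 by division by a prime above 3; -2 would force [p = 2], which is
    inert. *)
Lemma prime_qnorm p : prime p -> chi p = 1 -> exists x y, qnorm x y = p%:Z.
Proof.
move=> p_pr cp; have [k kp] := chi_prime_root p_pr cp.
have [x [y [xy0 x2 y2 dxy]]] := thue_pigeonhole k p_pr.
have dv : (p%:Z %| qnorm x y)%Z.
  have -> : qnorm x y = y ^+ 2 * qnorm k 1 + (x - k%:Z * y) * (x + k%:Z * y + y).
    by rewrite /qnorm; ring.
  by apply: rpredD; [exact: dvdz_mull|exact: dvdz_mulr].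
have [j qj] := dvdzP dv.
have q0 : qnorm x y != 0.
  apply: contraTneq xy0 => e; have y0 := qnorm_eq0 e.
  have : x ^+ 2 = 0 by move: e; rewrite y0 /qnorm; lia.
  by move/eqP; rewrite sqrf_eq0 y0 => /eqP ->.
have p_gt0 : 0 < p%:Z by have := prime_gt0 p_pr; lia.
have j_gt : -4 < j.
  (* Completing the square in [x] gives [4 j > -13]; completing it in [y] below gives
     [12 j < 13]. *)
  have e : 4 * (j * p%:Z) = (2 * x + y) ^+ 2 - 13 * y ^+ 2.
    by rewrite -qj /qnorm; ring.
  have s0 := sqr_ge0 (2 * x + y); rewrite ltNge; apply/negP => h.
  by have := ler_wpM2r (ltW p_gt0) h; lia.
have j_lt : j < 2.
  have e : 12 * (j * p%:Z) = 13 * x ^+ 2 - (6 * y - x) ^+ 2.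
    by rewrite -qj /qnorm; ring.
  have s0 := sqr_ge0 (6 * y - x); rewrite ltNge; apply/negP => h.
  by have := ler_wpM2r (ltW p_gt0) h; lia.
have j0 : j != 0 by apply: contraNneq q0 => j0; rewrite qj j0 mul0r.
have [j1|[j1|[j2|j3]]] : j = 1 \/ j = -1 \/ j = -2 \/ j = -3 by lia.
- by exists x, y; rewrite qj j1 mul1r.
- by have [x' [y' e]] := qnorm_opp qj; exists x', y'; rewrite e j1; lia.
- have [z pz] : exists z, p%:Z = 2 * z by apply: (@qnorm_even x y); rewrite qj j2.
  have p2 : p = 2%N.
    apply/eqP; rewrite eq_sym -(dvdn_prime2 _ p_pr) //; lia.
  by move: cp; rewrite p2.
- by apply: (@qnorm_div3 x y); rewrite qj j3.
Qed.

Definition good (n : nat) : bool := (0 < n)%N && all (fun p => chi p == 1) (primes n).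

Lemma goodM a b : good (a * b) = good a && good b.
Proof.
rewrite /good muln_gt0; case: (posnP a) => [//|a0]; case: (posnP b) => [|b0 /=].
  by rewrite /= andbF.
apply/allP/andP => [H|[/allP ha /allP hb] p].
  by split; apply/allP => p hp; apply: H; rewrite primesM // hp ?orbT.
by rewrite primesM // => /orP[/ha|/hb].
Qed.

Lemma good_prime p : prime p -> good p = (chi p == 1).
Proof. by move=> p_pr; rewrite /good prime_gt0 // primes_prime //= andbT. Qed.

Lemma good_gt0 n : good n -> (0 < n)%N. Proof. by case/andP. Qed.

Lemma good_ind (P : nat -> Prop) : P 1%N ->
  (forall p n, prime p -> chi p = 1 -> good n -> P n -> P (p * n)%N) ->
  forall n, good n -> P n.
Proof.
move=> P1 PM n; elim/ltn_ind: n => n IH gn.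
have n0 := good_gt0 gn.
have [n1|n1] := leqP n 1; first by have -> : n = 1%N by lia.
have p_pr := pdiv_prime n1; set p := pdiv n in p_pr.
have e : n = (p * (n %/ p))%N by rewrite mulnC divnK // pdiv_dvd.
move: gn; rewrite e goodM good_prime // => /andP[/eqP cp gm].
by apply: PM => //; apply: IH => //; rewrite ltn_Pdiv // prime_gt1.
Qed.

Lemma good_chi n : good n -> chi n = 1.
Proof.
by elim/good_ind => // p m _ cp _ cm; rewrite chiM cp cm.
Qed.

Lemma good_qnorm n : good n -> exists x y, qnorm x y = n%:Z.
Proof.
elim/good_ind => [|p m p_pr cp _ [c [d e]]]; first by exists 1, 0.
have [a [b e']] := prime_qnorm p_pr cp.
by eexists; eexists; rewrite PoszM -e' -e qnormM.
Qed.

(** * Estimates of Chebyshev and Mertens *)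

Section DivisorSums.
Variable V : nmodType.

Lemma sum_multiples (d N : nat) (G : nat -> V) : (0 < d)%N ->
  \sum_(1 <= n < N.+1 | (d %| n)%N) G n = \sum_(1 <= e < (N %/ d).+1) G (e * d)%N.
Proof.
move=> d0; elim: N => [|N IH]; first by rewrite div0n !big_geq.
rewrite big_mkcond big_nat_recr //= -big_mkcond IH divnS //.
case: ifP => dN /=; last by rewrite add0n addr0.
rewrite add1n [RHS]big_nat_recr //=; congr (_ + G _).
by have := divnS N d0; rewrite dN add1n => <-; rewrite divnK.
Qed.

Lemma sum_divisors_widen (n N : nat) (G : nat -> V) : (0 < n <= N)%N ->
  \sum_(1 <= d < n.+1 | (d %| n)%N) G d = \sum_(1 <= d < N.+1 | (d %| n)%N) G d.
Proof.
move=> /andP[n0 nN]; rewrite (big_nat_widen _ _ N.+1) //.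
by apply: eq_bigl => d; case: (boolP (d %| n)%N) => //= /(dvdn_leq n0); rewrite ltnS.
Qed.

Lemma sum_divisors_seq (n : nat) (G : nat -> V) : (0 < n)%N ->
  \sum_(1 <= d < n.+1 | (d %| n)%N) G d = \sum_(d <- divisors n) G d.
Proof.
move=> n0; rewrite -big_filter; apply: perm_big; apply: uniq_perm.
- by rewrite filter_uniq // iota_uniq.
- exact: divisors_uniq.
move=> d; rewrite mem_filter -dvdn_divisors // mem_index_iota ltnS.
by case: (boolP (d %| n)%N) => //= dn; rewrite (dvdn_gt0 n0) // (dvdn_leq n0).
Qed.

Lemma sum_divisor_exchange (F : nat -> nat -> V) (N : nat) :
  \sum_(1 <= n < N.+1) \sum_(1 <= d < n.+1 | (d %| n)%N) F d (n %/ d)%N =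
  \sum_(1 <= d < N.+1) \sum_(1 <= e < (N %/ d).+1) F d e.
Proof.
transitivity (\sum_(1 <= n < N.+1) \sum_(1 <= d < N.+1)
   (if (d %| n)%N then F d (n %/ d)%N else 0)).
  apply: eq_big_nat => n /andP[n0 nN].
  by rewrite (@sum_divisors_widen n N) ?n0 // big_mkcond.
rewrite exchange_big_nat /=; apply: eq_big_nat => d /andP[d0 _].
rewrite -big_mkcond /= sum_multiples //.
by apply: eq_bigr => e _; rewrite mulnK.
Qed.

(** Both sides run over the pairs with [d e <= N]. *)
Lemma sum_hyperbola_sym (F : nat -> nat -> V) (N : nat) :
  \sum_(1 <= d < N.+1) \sum_(1 <= e < (N %/ d).+1) F d e =
  \sum_(1 <= e < N.+1) \sum_(1 <= d < (N %/ e).+1) F d e.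
Proof.
have W (G : nat -> nat -> V) : \sum_(1 <= d < N.+1) \sum_(1 <= e < (N %/ d).+1) G d e =
    \sum_(1 <= d < N.+1) \sum_(1 <= e < N.+1) (if (e * d <= N)%N then G d e else 0).
  apply: eq_big_nat => d /andP[d0 _]; rewrite -big_mkcond /=.
  rewrite (big_nat_widen _ _ N.+1) ?ltnS ?leq_div //.
  by apply: eq_bigl => e; rewrite ltnS leq_divRL.
rewrite W exchange_big_nat /= (W (fun e d => F d e)).
by apply: eq_bigr => e _; apply: eq_bigr => d _; rewrite mulnC.
Qed.

End DivisorSums.

Section Mangoldt.
Variable R : realType.
Implicit Types (n d p k N : nat).

(** A number above 1 is a prime power exactly when it is a power of its least prime factor. *)
Definition mangoldt n : R :=
  if (1 < n)%N && (n == pdiv n ^ logn (pdiv n) n)%N then ln (pdiv n)%:R else 0.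

Lemma lnN_ge0 n : 0 <= ln (n%:R : R).
Proof.
case: n => [|n]; last by rewrite ln_ge0 // ler1n.
by rewrite ln0.
Qed.

Lemma ler_lnN a b : (0 < a)%N -> (a <= b)%N -> ln a%:R <= ln b%:R :> R.
Proof. by move=> a0 ab; rewrite ler_ln ?posrE ?ltr0n ?ler_nat // (leq_trans a0). Qed.

Lemma mangoldt_pow p k : prime p -> mangoldt (p ^ k.+1) = ln p%:R.
Proof.
move=> p_pr; rewrite /mangoldt pdiv_pfactor // pfactorK // eqxx andbT.
by rewrite -(exp1n k.+1) ltn_exp2r // prime_gt1.
Qed.

Lemma mangoldt_primepow n : mangoldt n != 0 -> exists p k, prime p /\ n = (p ^ k.+1)%N.
Proof.
rewrite /mangoldt; case: ifP => [/andP[n1 /eqP en] _|]; last by rewrite eqxx.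
have p_pr := pdiv_prime n1.
exists (pdiv n), (logn (pdiv n) n).-1; split=> //.
by rewrite prednK // logn_gt0 mem_primes p_pr pdiv_dvd ltnW.
Qed.

Lemma mangoldt_ge0 n : 0 <= mangoldt n.
Proof. by rewrite /mangoldt; case: ifP => // _; exact: lnN_ge0. Qed.

Lemma mangoldt_le_ln n : mangoldt n <= ln n%:R.
Proof.
rewrite /mangoldt; case: ifP => [/andP[n1 _]|_]; last exact: lnN_ge0.
by rewrite ler_lnN ?pdiv_gt0 // pdiv_leq // ltnW.
Qed.

(** Induction through [n = p m]: among the divisors of [n] that do not divide [m], the only prime
    power is [p ^ (logn p m).+1], and it contributes [ln p]. *)
Lemma ln_eq_sum_mangoldt n : (0 < n)%N ->
  ln n%:R = \sum_(1 <= d < n.+1 | (d %| n)%N) mangoldt d.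
Proof.
elim/ltn_ind: n => n IH n0.
have [n1|n1] := leqP n 1.
  have -> : n = 1%N by lia.
  by rewrite ln1 big_mkcond /= big_nat1 /= /mangoldt.
have p_pr := pdiv_prime n1; set p := pdiv n in p_pr.
have [m en] : exists m, n = (p * m)%N.
  by exists (n %/ p)%N; rewrite mulnC divnK // pdiv_dvd.
have p1 := prime_gt1 p_pr.
have m0 : (0 < m)%N by case: (m) en n0 => // ->; rewrite muln0.
have mn : (m < n)%N by rewrite en ltn_Pmull.
rewrite {1}en natrM lnM ?posrE ?ltr0n ?(prime_gt0 p_pr) // (IH m) //.
have mnn : (0 < m <= n)%N by rewrite m0 ltnW.
rewrite (sum_divisors_widen _ mnn) addrC.
rewrite [RHS](bigID (fun d => (d %| m)%N)) /=; congr (_ + _).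
  apply: eq_bigl => d; case: (boolP (d %| m)%N); rewrite ?andbF ?andbT // => dm.
  by rewrite en dvdn_mull.
set q := (p ^ (logn p m).+1)%N.
transitivity (\sum_(1 <= d < n.+1 | d == q) ln p%:R : R).
  rewrite big_nat1_eq ifT //; rewrite /q expn_gt0 prime_gt0 //= ltnS.
  apply: dvdn_leq => //; rewrite en expnS dvdn_pmul2l ?prime_gt0 //.
  exact: pfactor_dvdnn.
rewrite [LHS]big_mkcond [RHS]big_mkcond /=; apply: eq_bigr => d _; case: eqP => [->|dq].
  rewrite ifT ?mangoldt_pow // en /q expnS dvdn_pmul2l ?prime_gt0 // pfactor_dvdnn /=.
  by rewrite -expnS pfactor_dvdn // ltnn.
case: ifP => // /andP[dn dm].
(* A power of a prime other than [p] that divides [p m] divides [m], so the prime is [p], and the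
   exponent is forced. *)
have [->//|/mangoldt_primepow[r [k [r_pr dE]]]] := eqVneq (mangoldt d) 0.
exfalso; case: dq; rewrite dE.
have [rp|rp] := eqVneq r p; last first.
  move: dm; rewrite dE -(@Gauss_dvdr _ p) -?en -?dE ?dn // dE.
  by rewrite coprimeXl // prime_coprime // dvdn_prime2.
move: dn dm; rewrite dE rp en !pfactor_dvdn ?muln_gt0 ?(prime_gt0 p_pr) //.
rewrite lognM ?(prime_gt0 p_pr) //.
rewrite logn_prime // eqxx add1n -ltnNge /q => h1 h2; congr (_ ^ _)%N; lia.
Qed.

(** The logarithm is the sum of [mangoldt] over divisors, and [h] splits along [n = d e]. This
    serves for the constant 1, for [chi n / n] and for the indicator of good integers. *)
Lemma sum_cmult_ln (h : nat -> R) N : (forall a b, h (a * b)%N = h a * h b) ->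
  \sum_(1 <= n < N.+1) h n * ln n%:R =
  \sum_(1 <= d < N.+1) h d * mangoldt d * \sum_(1 <= e < (N %/ d).+1) h e.
Proof.
move=> hM; under [RHS]eq_bigr do rewrite big_distrr /=.
rewrite -(sum_divisor_exchange (fun d e => h d * mangoldt d * h e)).
apply: eq_big_nat => n /andP[n0 _]; rewrite ln_eq_sum_mangoldt // big_distrr /=.
apply: eq_bigr => d dn; rewrite mulrAC -hM.
by rewrite mulnC divnK.
Qed.

End Mangoldt.

Section Chebyshev.
Variable R : realType.
Implicit Types (n d p k N : nat).

Lemma lnS_le n : (0 < n)%N -> ln n.+1%:R - ln n%:R <= n%:R^-1 :> R.
Proof.
move=> n0; have n0' : 0 < n%:R :> R by rewrite ltr0n.
rewrite -ln_div ?posrE ?ltr0n // -natr1 mulrDl divff ?gt_eqF // mul1r.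
by apply: le_ln1Dx; rewrite (lt_trans (@ltrN10 R)) // invr_gt0.
Qed.

Lemma sum_ln_le N : \sum_(1 <= n < N.+1) ln n%:R <= N%:R * ln N%:R :> R.
Proof.
rewrite -[X in X%:R * _](subn1 N.+1) -(mul1r ((N.+1 - 1)%:R * _)) mul1r mulr_natl -sumr_const_nat.
by apply: ler_sum_nat => n /andP[n0 nN]; rewrite ler_lnN.
Qed.

Lemma sum_ln_ge N : N%:R * ln N%:R - N%:R <= \sum_(1 <= n < N.+1) ln n%:R :> R.
Proof.
elim: N => [|N IH]; first by rewrite mul0r big_geq // subr0.
rewrite big_nat_recr //=; case: N IH => [|N] IH.
  by rewrite big_geq // ln1; lra.
have h : N.+1%:R * (ln N.+2%:R - ln N.+1%:R) <= 1 :> R.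
  by rewrite mulrC -ler_pdivlMr ?ltr0n // mul1r lnS_le.
have e l : N.+2%:R * l = N.+1%:R * l + l :> R by rewrite -natr1; ring.
by have e1 : N.+2%:R = N.+1%:R + 1 :> R by [rewrite natr1]; rewrite e; lra.
Qed.

Lemma sum_mangoldt_div N :
  \sum_(1 <= n < N.+1) ln n%:R = \sum_(1 <= d < N.+1) mangoldt R d * (N %/ d)%:R :> R.
Proof.
have := @sum_cmult_ln R (fun=> 1) N (fun _ _ => esym (mulr1 1)).
under eq_bigr do rewrite mul1r; move=> ->.
by apply: eq_bigr => d _; rewrite mul1r sumr_const_nat subn1.
Qed.

Definition psi N : R := \sum_(1 <= d < N.+1) mangoldt R d.

Lemma ln3_le2 : ln 3 <= 2 :> R.
Proof. by have := @le_ln1Dx R 2; rewrite (_ : 1 + 2 = 3) //; apply; lra. Qed.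

(* The upper half of Chebyshev's argument: [N %/ d - 2 * (N./2 %/ d)] is
   nonnegative, and equals 1 for [N./2 < d <= N]. *)
Lemma psi_half N : psi N <= psi N./2 + 4 * N%:R.
Proof.
set h := N./2.
have hN : (h <= N)%N by rewrite /h; lia.
have main : psi N - psi h <=
    \sum_(1 <= n < N.+1) ln n%:R - 2 * \sum_(1 <= n < h.+1) ln n%:R.
  rewrite !sum_mangoldt_div /psi.
  have wid : \sum_(1 <= d < h.+1) mangoldt R d * (h %/ d)%:R =
             \sum_(1 <= d < N.+1) mangoldt R d * (h %/ d)%:R.
    rewrite [RHS](big_cat_nat _ (n := h.+1)) //= [X in _ + X]big1_seq ?addr0 // => d.
    rewrite mem_index_iota => /andP[_ /andP[hd _]].
    by rewrite divn_small ?mulr0.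
  rewrite wid [X in X - _](big_cat_nat _ (n := h.+1)) //= [X in X - _]addrC addrK.
  rewrite [X in _ <= X - _](big_cat_nat _ (n := h.+1)) //=.
  rewrite [X in _ <= _ - 2 * X](big_cat_nat _ (n := h.+1)) //=.
  rewrite mulrDr opprD addrACA -[X in X <= _]add0r; apply: lerD.
    rewrite subr_ge0 mulr_sumr; apply: ler_sum_nat => d /andP[d0 _].
    rewrite mulrCA ler_wpM2l ?mangoldt_ge0 // -natrM ler_nat leq_divRL // -mulnA.
    by have := leq_divM h d; rewrite /h; lia.
  rewrite [X in _ - 2 * X]big1_seq ?mulr0 ?subr0.
    apply: ler_sum_nat => d /andP[hd dN]; rewrite -[X in X <= _]mulr1.
    by rewrite ler_wpM2l ?mangoldt_ge0 // ler1n divn_gt0 //; lia.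
  move=> d; rewrite mem_index_iota => /andP[_ /andP[hd _]].
  by rewrite divn_small ?mulr0.
have [h0|h0] := posnP h.
  have {}main : psi N <= psi h.
    have : (N = 0 \/ N = 1)%N by lia.
    rewrite h0 /psi [in X in _ <= X]big_geq //; case=> ->; first by rewrite big_geq.
    by rewrite big_nat1 /mangoldt.
  by rewrite (le_trans main) // lerDl mulr_ge0 ?ler0n.
have hR : 0 < h%:R :> R by rewrite ltr0n.
have t1 := sum_ln_le N; have t2 := sum_ln_ge h.
(* As [h] is positive, [N <= 3 h], and [ln 3 <= 2]. *)
have : ln N%:R <= ln h%:R + 2 :> R.
  rewrite addrC -lerBlDr -ln_div ?posrE ?ltr0n //; last by lia.
  apply: (le_trans _ ln3_le2); rewrite ler_ln ?posrE ?divr_gt0 ?ltr0n //; last by lia.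
  by rewrite ler_pdivrMr // -natrM ler_nat /h; lia.
have N0 : (0 < N)%N by lia.
have : ln N%:R <= N%:R :> R by rewrite ltW // ln_sublinear // ltr0n.
have : N%:R = (2 * h + odd N)%:R :> R.
  by rewrite mul2n addnC odd_double_half.
rewrite natrD natrM => eN lnN1 lnN2.
have m1 : h%:R * ln N%:R <= h%:R * (ln h%:R + 2) :> R by rewrite ler_wpM2l ?ler0n.
case: (odd N) eN => /= eN.
  have e : N%:R * ln N%:R = 2 * (h%:R * ln N%:R) + ln N%:R :> R by rewrite eN; ring.
  by rewrite e in t1; lra.
have e : N%:R * ln N%:R = 2 * (h%:R * ln N%:R) :> R by rewrite eN; ring.
by rewrite e in t1; lra.
Qed.

Lemma psi_le N : psi N <= 8 * N%:R.
Proof.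
elim/ltn_ind: N => N IH; have [->|N0] := posnP N.
  by rewrite /psi big_geq // mulr0.
have hN : (N./2 < N)%N by lia.
have h2 : 2 * (N./2)%:R <= N%:R :> R by rewrite -natrM ler_nat; lia.
by have := IH _ hN; have := psi_half N; lra.
Qed.

Lemma mertens_ge N : (0 < N)%N ->
  ln N%:R - 1 <= \sum_(1 <= d < N.+1) mangoldt R d / d%:R :> R.
Proof.
move=> N0; have NR : 0 < N%:R :> R by rewrite ltr0n.
rewrite -(ler_pM2l NR) mulrBr mulr1 (le_trans (sum_ln_ge N)) // sum_mangoldt_div.
rewrite mulr_sumr; apply: ler_sum_nat => d /andP[d0 _].
rewrite mulrCA ler_wpM2l ?mangoldt_ge0 // ler_pdivlMr ?ltr0n // -natrM ler_nat.
exact: leq_divM.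
Qed.

Lemma divn_natr_le d N : (0 < d)%N -> N%:R / d%:R <= (N %/ d)%:R + 1 :> R.
Proof.
move=> d0; rewrite ler_pdivrMr ?ltr0n // natr1 -natrM ler_nat.
by rewrite ltnW // -ltn_divLR // ltnS.
Qed.

(** Replacing [N %/ d] by [N / d] in the expansion of the sum of logarithms costs at most
    [psi N <= 8 N]. *)
Lemma mertens_le N : (0 < N)%N ->
  \sum_(1 <= d < N.+1) mangoldt R d / d%:R <= ln N%:R + 8 :> R.
Proof.
move=> N0; have NR : 0 < N%:R :> R by rewrite ltr0n.
rewrite -(ler_pM2l NR) mulrDr.
have H : N%:R * \sum_(1 <= d < N.+1) mangoldt R d / d%:R
    <= \sum_(1 <= d < N.+1) mangoldt R d * (N %/ d)%:R + psi N :> R.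
  rewrite /psi -big_split /= mulr_sumr; apply: ler_sum_nat => d /andP[d0 _].
  rewrite mulrCA -[X in _ + X]mulr1 -mulrDr ler_wpM2l ?mangoldt_ge0 //.
  exact: divn_natr_le.
rewrite -sum_mangoldt_div in H; have := psi_le N; have := sum_ln_le N; lra.
Qed.

End Chebyshev.

(** * Sums of the character and positivity of L(1, chi) *)

Section CharacterSums.
Variable R : realType.
Implicit Types (n d p k N : nat).

Lemma abel_bound (a g : nat -> R) (Q : R) m : 0 <= Q ->
  (forall n, (m <= n)%N -> `|\sum_(m <= k < n) a k| <= Q) ->
  (forall n, (m <= n)%N -> 0 <= g n.+1 <= g n) ->
  forall n, (m < n)%N -> `|\sum_(m <= k < n) a k * g k| <= Q * g m.
Proof.
move=> Q0 aQ gm.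
(* Partial summation with the boundary term subtracted, which makes the bound telescope in an
   induction on the length. *)
have H j : `|\sum_(m <= k < m + j) a k * g k - (\sum_(m <= k < m + j) a k) * g (m + j)%N|
    <= Q * (g m - g (m + j)%N).
  elim: j => [|j IH]; first by rewrite addn0 !big_geq // mul0r !subrr normr0 mulr0.
  rewrite addnS !big_nat_recr ?leq_addr //=.
  have /andP[g1 g2] := gm (m + j)%N (leq_addr _ _).
  have a1 := aQ (m + j).+1 (leqW (leq_addr _ _)).
  rewrite big_nat_recr ?leq_addr //= in a1.
  set S := \sum_(m <= k < m + j) a k in IH a1 *.
  set T := \sum_(m <= k < m + j) a k * g k in IH *.
  have -> : T + a (m + j)%N * g (m + j)%N - (S + a (m + j)%N) * g (m + j).+1 =
    (T - S * g (m + j)%N) + (S + a (m + j)%N) * (g (m + j)%N - g (m + j).+1) by ring.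
  rewrite (le_trans (ler_normD _ _)) // normrM (ger0_norm (x := g _ - _)) ?subr_ge0 //.
  have h : `|S + a (m + j)%N| * (g (m + j)%N - g (m + j).+1) <=
           Q * (g (m + j)%N - g (m + j).+1) by rewrite ler_wpM2r ?subr_ge0.
  by lra.
move=> n mn; have := H (n - m)%N; rewrite subnKC 1?ltnW // => Hn.
have gn : 0 <= g n by case: (n) mn => // k mk; have /andP[] := gm k mk.
have h : `|(\sum_(m <= k < n) a k) * g n| <= Q * g n.
  by rewrite normrM (ger0_norm gn) ler_wpM2r // aQ // ltnW.
have := ler_normD (\sum_(m <= k < n) a k * g k - (\sum_(m <= k < n) a k) * g n)
  ((\sum_(m <= k < n) a k) * g n).
by rewrite subrK; lra.
Qed.

(** Partial sums kept in the integers, where they can be evaluated by computation. *)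
Fixpoint chi_psum n : int := if n is n'.+1 then chi_psum n' + chi n' else 0.

(** The character sums to 0 over a period of 39, so only 39 partial sums need evaluation. *)
Lemma chi_psum_bound n : (-2 <= chi_psum n <= 2).
Proof.
have per k : chi_psum (k + 39) = chi_psum k.
  elim: k => [|k IH]; first by vm_compute.
  by rewrite addSn /= IH; congr (_ + _); rewrite chi_mod modnDr -chi_mod.
have per' q r : chi_psum (q * 39 + r) = chi_psum r.
  elim: q => [|q IH]; first by rewrite mul0n.
  by rewrite mulSn -addnA addnC per.
have /allP H : all (fun r => -2 <= chi_psum r <= 2) (iota 0 39) by vm_compute.
by rewrite (divn_eq n 39) per' H // mem_iota /= ltn_mod.
Qed.

Lemma chi_sum_bound m n : (m <= n)%N -> `|\sum_(m <= k < n) (chi k)%:~R| <= 4 :> R.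
Proof.
move=> mn; have -> : \sum_(m <= k < n) (chi k)%:~R = (chi_psum n - chi_psum m)%:~R :> R.
  have e j : \sum_(m <= k < m + j) (chi k)%:~R = (chi_psum (m + j) - chi_psum m)%:~R :> R.
    elim: j => [|j IH]; first by rewrite addn0 big_geq // subrr.
    rewrite addnS big_nat_recr ?leq_addr //= IH -rmorphD /=; congr (_%:~R); ring.
  by have := e (n - m)%N; rewrite subnKC.
have := chi_psum_bound m; have := chi_psum_bound n => b1 b2.
by rewrite -intr_norm (_ : 4 = 4%:~R) // ler_int; lia.
Qed.

Lemma chi_abs n : `|(chi n)%:~R| <= 1 :> R.
Proof. by rewrite /chi; case: ifP => _; [|case: ifP => _]; rewrite ?rmorphN ?normrN ?normr0 ?normr1. Qed.

(** Partial sums of the series for L(1, chi). *)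
Definition Achi N : R := \sum_(1 <= n < N.+1) (chi n)%:~R / n%:R.

Lemma Achi_diff N M : (N <= M)%N -> `|Achi M - Achi N| <= 4 / N.+1%:R.
Proof.
rewrite leq_eqVlt => /orP[/eqP->|NM].
  by rewrite subrr normr0 divr_ge0.
rewrite /Achi (big_cat_nat _ (n := N.+1) (p := M.+1)) //=; last by rewrite ltnS ltnW.
rewrite [X in `|X - _|]addrC addrK.
apply: (@abel_bound (fun n => (chi n)%:~R) (fun n => n%:R^-1) 4 N.+1) => //.
  by move=> n h; exact: chi_sum_bound.
move=> n h; rewrite invr_ge0 ler0n /= lef_pV2 ?posrE ?ltr0n ?ler_nat //.
by rewrite (leq_trans _ h).
Qed.

(** The first 17 terms add up to at least [1/4 + 4/18], and the later ones change the sum by at most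
    [4/18]. *)
Lemma Achi_ge N : (17 <= N)%N -> 4^-1 <= Achi N.
Proof.
move=> h; have := Achi_diff h; have : 4^-1 + 4 / 18 <= Achi 17.
  rewrite /Achi; do 17 (rewrite big_ltn //); rewrite big_geq //.
  by rewrite /chi /=; lra.
by rewrite ler_norml; lra.
Qed.

Lemma Achi_div_diff N d : (0 < d)%N -> (0 < N)%N ->
  `|Achi (N %/ d) - Achi N| <= 4 * d%:R / N%:R.
Proof.
move=> d0 N0; rewrite distrC; apply: (le_trans (Achi_diff (leq_div _ _))).
rewrite -mulrA ler_wpM2l // -[X in _ <= X]invrK lef_pV2 ?posrE ?ltr0n // ?invr_gt0 ?divr_gt0 ?ltr0n //.
by rewrite invf_div -natr1; exact: divn_natr_le.
Qed.

Lemma ln2_ge_half : 2^-1 <= ln 2 :> R.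
Proof.
have := @le_ln1Dx R (- 2^-1); rewrite (_ : 1 + - 2^-1 = 2^-1); last by lra.
by rewrite lnV ?posrE // lerN2; apply; lra.
Qed.

(** Monotonicity needs [ln n >= 1]; from 8 on this follows from [ln 2 >= 1/2]. *)
Lemma ln_div_dec n : (8 <= n)%N -> 0 <= ln (n.+1%:R : R) / n.+1%:R <= ln n%:R / n%:R.
Proof.
move=> n8; have n0 : (0 < n)%N by lia.
rewrite divr_ge0 ?lnN_ge0 ?ler0n //= ler_pdivrMr ?ltr0n // mulrAC ler_pdivlMr ?ltr0n //.
have l8 : 1 <= ln n%:R :> R.
  apply: (@le_trans _ _ (ln 8)); last by rewrite ler_lnN.
  rewrite (_ : 8 = 2 ^+ 3); last by rewrite -natrX.
  by rewrite lnXn // -[_ *+ 3]mulr_natl; have := ln2_ge_half; lra.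
have := lnS_le R n0; rewrite -(ler_pM2r (x := n%:R)) ?ltr0n // mulVf ?pnatr_eq0 -?lt0n //.
have e l : l * n.+1%:R = l * n%:R + l :> R by rewrite -natr1; ring.
by rewrite e; lra.
Qed.

Lemma chi_ln_sum_bound N : (17 <= N)%N ->
  `|\sum_(1 <= n < N.+1) (chi n)%:~R / n%:R * ln n%:R| <= 11 :> R.
Proof.
move=> N17; rewrite (big_cat_nat _ (n := 8)) //=; last by lia.
have le1 n : (0 < n)%N -> ln n%:R / n%:R <= 1 :> R.
  by move=> n0; rewrite ler_pdivrMr ?ltr0n // mul1r ltW // ln_sublinear // ltr0n.
rewrite (le_trans (ler_normD _ _)) // (_ : 11 = 7 + 4); last by rewrite -natrD.
apply: lerD.
  apply: (le_trans (ler_norm_sum _ _ _)).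
  have -> : 7 = \sum_(1 <= n < 8) 1 :> R by rewrite sumr_const_nat.
  apply: ler_sum_nat => n /andP[n0 _]; rewrite -mulrA normrM mulrC -[X in _ <= X]mulr1.
  rewrite ler_pM ?normr_ge0 ?chi_abs // ger0_norm; last by rewrite mulr_ge0 ?invr_ge0 ?ler0n ?lnN_ge0.
  by rewrite mulrC le1.
under eq_bigr do rewrite -mulrA [X in _ * X]mulrC.
apply: (@le_trans _ _ (4 * (ln 8%:R / 8%:R))); last by have := le1 8%N isT; lra.
apply: (@abel_bound (fun n => (chi n)%:~R) (fun n => ln n%:R / n%:R) 4 8) => //.
- by move=> n h; exact: chi_sum_bound.
- by move=> n h; exact: ln_div_dec.
- by lia.
Qed.

(** The bounded sum of [chi n * ln n / n] equals the sum of
    [chi d * mangoldt d / d * Achi (N %/ d)]. Replacing [Achi (N %/ d)] by [Achi N] costs at most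
    [4 psi N / N <= 32]; then [Achi N >= 1/4] is divided out, giving 4 times 43. *)
Lemma chi_mangoldt_sum_bound N : (17 <= N)%N ->
  `|\sum_(1 <= d < N.+1) (chi d)%:~R * (mangoldt R d / d%:R)| <= 200 :> R.
Proof.
move=> N17; have N0 : (0 < N)%N by lia.
have NR : 0 < N%:R :> R by rewrite ltr0n.
set Z := \sum_(_ <= _ < _) _.
have hM a b : (chi (a * b))%:~R / (a * b)%:R =
    (chi a)%:~R / a%:R * ((chi b)%:~R / b%:R) :> R.
  by rewrite chiM rmorphM natrM invfM; ring.
have := chi_ln_sum_bound N17.
rewrite (@sum_cmult_ln R (fun n => (chi n)%:~R / n%:R) N hM) => hB.
have hE : `|\sum_(1 <= d < N.+1) ((chi d)%:~R / d%:R * mangoldt R d) * (Achi (N %/ d) - Achi N)|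
    <= 32 :> R.
  apply: (le_trans (ler_norm_sum _ _ _)).
  apply: (@le_trans _ _ (\sum_(1 <= d < N.+1) 4 / N%:R * mangoldt R d)).
    apply: ler_sum_nat => d /andP[d0 dN]; rewrite normrM.
    have d0R : 0 < d%:R :> R by rewrite ltr0n.
    have := Achi_div_diff d0 N0 => hd.
    rewrite !normrM (ger0_norm (mangoldt_ge0 R d)) normfV (ger0_norm (ltW d0R)).
    apply: (@le_trans _ _ ((1 / d%:R * mangoldt R d) * (4 * d%:R / N%:R))); last first.
      by rewrite le_eqVlt; apply/orP; left; apply/eqP; field; rewrite !gt_eqF.
    apply: ler_pM => //; first by rewrite !mulr_ge0 ?normr_ge0 ?invr_ge0 ?ler0n ?mangoldt_ge0.
    rewrite ler_wpM2r ?mangoldt_ge0 // ler_wpM2r ?invr_ge0 ?ler0n //; exact: chi_abs.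
  rewrite -mulr_sumr -/(psi R N) mulrAC ler_pdivrMr //.
  by have := psi_le R N; lra.
have eZ : Achi N * Z = \sum_(1 <= d < N.+1) (chi d)%:~R / d%:R * mangoldt R d * Achi (N %/ d)
  - \sum_(1 <= d < N.+1) ((chi d)%:~R / d%:R * mangoldt R d) * (Achi (N %/ d) - Achi N).
  rewrite -sumrB /Z mulr_sumr; apply: eq_bigr => d _; ring.
have hAZ : `|Achi N * Z| <= 43.
  by rewrite eZ (le_trans (ler_normB _ _)) //; move: hB; rewrite -/(Achi _) => hB; lra.
have A4 := Achi_ge N17; rewrite normrM ger0_norm in hAZ; last by lra.
have : 4^-1 * `|Z| <= Achi N * `|Z| by rewrite ler_wpM2r.
by lra.
Qed.

End CharacterSums.

(** * Products of split primes *)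

Section GoodPrimes.
Variable R : realType.
Implicit Types (n d p k N : nat).

Lemma good_pow p k : prime p -> good (p ^ k.+1) = (chi p == 1).
Proof.
move=> p_pr; elim: k => [|k IH]; first by rewrite expn1 good_prime.
by rewrite expnS goodM good_prime // IH andbb.
Qed.

Lemma chi_values n : [\/ chi n = 1, chi n = -1 | chi n = 0 /\ ((3 %| n) || (13 %| n))%N].
Proof.
rewrite /chi; case: ifP => h; first by constructor 3.
by case: ifP => _; [constructor 1|constructor 2].
Qed.

(** Only powers of [q] contribute. Splitting off [q] itself bounds the sum by [ln q / q] plus
    [1 / q] times the same sum up to [N %/ q]. *)
Lemma sum_mangoldt_dvd_le q N : prime q ->
  \sum_(1 <= d < N.+1 | (q %| d)%N) mangoldt R d / d%:R <= ln q%:R :> R.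
Proof.
move=> q_pr; have q0 := prime_gt0 q_pr; have q1 := prime_gt1 q_pr.
have qR : 0 < q%:R :> R by rewrite ltr0n.
elim/ltn_ind: N => N IH; rewrite sum_multiples //.
have [h0|h0] := posnP (N %/ q); first by rewrite h0 big_geq // lnN_ge0.
rewrite big_ltn ?ltnS // mul1n.
have N0 : (0 < N)%N by case: (N) h0 => //; rewrite div0n.
have {}IH := IH _ (ltn_Pdiv q1 N0).
have Lq : mangoldt R q = ln q%:R by rewrite -(mangoldt_pow R 0 q_pr) expn1.
have : \sum_(2 <= e < (N %/ q).+1) mangoldt R (e * q) / (e * q)%:R <=
       q%:R^-1 * \sum_(1 <= d < (N %/ q).+1 | (q %| d)%N) mangoldt R d / d%:R.
  rewrite [in X in _ <= _ * X]big_mkcond (big_ltn (m := 1)) ?ltnS //= gtnNdvd // add0r mulr_sumr.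
  apply: ler_sum_nat => e /andP[e2 _].
  have e0 : (0 < e)%N by lia.
  have [->|] := eqVneq (mangoldt R (e * q)) 0.
    rewrite mul0r mulr_ge0 ?invr_ge0 ?ler0n //; case: ifP => // _.
    by rewrite divr_ge0 ?mangoldt_ge0.
  move=> /mangoldt_primepow[p [k [p_pr epk]]].
  have qp : q = p.
    have : (q %| p ^ k.+1)%N by rewrite -epk dvdn_mull.
    by rewrite Euclid_dvdX // andbT dvdn_prime2 // => /eqP.
  move: epk; rewrite -{}qp expnS mulnC => /eqP; rewrite eqn_pmul2l // => /eqP ek.
  have [k' kk] : exists k', k = k'.+1.
    by case: k ek => [|k']; [rewrite expn0; lia|exists k'].
  rewrite ek kk dvdn_exp // -expnS !mangoldt_pow // expnS natrM invfM.
  by rewrite le_eqVlt; apply/orP; left; apply/eqP; ring.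
have IHq : q%:R^-1 * \sum_(1 <= d < (N %/ q).+1 | (q %| d)%N) mangoldt R d / d%:R
    <= q%:R^-1 * ln q%:R by rewrite ler_wpM2l ?invr_ge0 ?ler0n.
have : 2 * (q%:R^-1 * ln q%:R) <= ln q%:R :> R.
  rewrite mulrA -[X in _ <= X]mul1r ler_wpM2r ?lnN_ge0 //.
  by rewrite ler_pdivrMr // mul1r (ler_nat _ 2).
by rewrite Lq; lra.
Qed.

(** For [l = ln x] and [l' = ln (x + 1)] this makes [(2 + ln x) / x] a telescoping majorant for the
    sum of [ln e / e^2]. *)
Lemma ln_sqr_telescope (x l l' : R) : 1 <= x -> 0 <= l' -> l' - l <= x^-1 ->
  l' / (x + 1) ^+ 2 <= (2 + l) / x - (2 + l') / (x + 1).
Proof.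
move=> x1 l'0 h; have x0 : 0 < x by lra.
have xp : 0 < x + 1 by lra.
have -> : (2 + l) / x - (2 + l') / (x + 1) = ((2 + l') - (x + 1) * (l' - l)) / (x * (x + 1)).
  by field; rewrite !gt_eqF.
apply: (@le_trans _ _ (l' / (x * (x + 1)))).
  rewrite ler_wpM2l // lef_pV2 ?posrE ?expr2 ?mulr_gt0 // ler_wpM2r //; lra.
have pos : 0 <= (x * (x + 1))^-1 by rewrite invr_ge0 mulr_ge0 // ltW.
rewrite ler_wpM2r //.
have := ler_wpM2l (ltW xp) h.
have -> : (x + 1) * x^-1 = 1 + x^-1 by field; rewrite gt_eqF.
have : x^-1 <= 1 by rewrite invf_le1.
by move: (x^-1) => y; lra.
Qed.

Lemma sum_ln_sqr_le N : \sum_(1 <= e < N.+1) ln e%:R / (e ^ 2)%:R <= 2 :> R.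
Proof.
pose g n : R := (2 + ln n%:R) / n%:R.
have g0 n : 0 <= g n by rewrite divr_ge0 ?ler0n // addr_ge0 ?lnN_ge0.
have H M : \sum_(1 <= e < M.+2) ln e%:R / (e ^ 2)%:R <= g 1%N - g M.+1 :> R.
  elim: M => [|M IH]; first by rewrite big_nat1 ln1 mul0r subrr.
  rewrite big_nat_recr //=.
  have x1 : 1 <= M.+1%:R :> R by rewrite ler1n.
  have := ln_sqr_telescope x1 (lnN_ge0 R M.+2) (lnS_le R (isT : 0 < M.+1)%N).
  rewrite natr1 -natrX -/(g M.+1) -/(g M.+2).
  by move: (ln _ / _) (g _) (g _) (g _) IH => a b c d; lra.
case: N => [|N]; first by rewrite big_geq.
have -> : 2 = g 1%N by rewrite /g ln1; lra.
by apply: (le_trans (H N)); have := g0 N.+1; lra.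
Qed.

Definition goodR n : R := (good n)%:R.

Lemma goodR_ge0 n : 0 <= goodR n. Proof. exact: ler0n. Qed.

Lemma goodRM a b : goodR (a * b) = goodR a * goodR b.
Proof. by rewrite /goodR goodM -natrM mulnb. Qed.

Lemma goodR_mangoldt_le d : goodR d * mangoldt R d <= (mangoldt R d + (chi d)%:~R * mangoldt R d) / 2.
Proof.
have L0 := mangoldt_ge0 R d; rewrite /goodR; case: (boolP (good d)) => [/good_chi -> /=|_ /=].
  by lra.
by have := chi_abs R d; rewrite ler_norml => /andP[h _]; nra.
Qed.

(** On prime powers, [(1 + chi) / 2] exceeds the indicator of good integers only at even powers of
    primes with [chi p = -1], which are squares, and at powers of 3 and 13. *)
Lemma goodR_mangoldt_ge N d : (d <= N)%N ->
  (mangoldt R d + (chi d)%:~R * mangoldt R d) / 2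
  - \sum_(1 <= e < N.+1) (if (e ^ 2 == d)%N then mangoldt R d else 0)
  - (if (3 %| d)%N then mangoldt R d else 0) - (if (13 %| d)%N then mangoldt R d else 0)
  <= goodR d * mangoldt R d.
Proof.
move=> dN; have L0 := mangoldt_ge0 R d.
set S := \sum_(_ <= _ < _) _.
have S0 : 0 <= S by apply: sumr_ge0 => e _; case: ifP.
have [Ld|] := eqVneq (mangoldt R d) 0.
  by move: S0; rewrite Ld !if_same; lra.
move=> /mangoldt_primepow[p [k [p_pr dpk]]].
have i3 : 0 <= (if (3 %| d)%N then mangoldt R d else 0) by case: ifP.
have i13 : 0 <= (if (13 %| d)%N then mangoldt R d else 0) by case: ifP.
rewrite {1}/goodR dpk good_pow // -dpk.
case: (chi_values p) => [cp|cp|[cp dp]]; rewrite cp.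
- by rewrite dpk chiX cp expr1n -dpk /=; lra.
- have [ko|ke] := boolP (odd k.+1).
    by rewrite {2}dpk chiX cp -signr_odd ko /=; lra.
  have Sd : mangoldt R d <= S.
    pose s := (p ^ (k.+1)./2)%N.
    have sd : (s ^ 2 = d)%N by rewrite dpk -expnM muln2 -[RHS]/(p ^ k.+1)%N -[in RHS](odd_double_half k.+1) (negbTE ke).
    have s0 : (0 < s)%N by rewrite expn_gt0 prime_gt0.
    have sN : (s <= N)%N by rewrite (leq_trans _ dN) // -sd -mulnn leq_pmulr.
    rewrite /S (bigD1_seq s) ?iota_uniq ?mem_index_iota ?s0 ?ltnS //= sd eqxx.
    by rewrite lerDl sumr_ge0 // => e _; case: ifP.
  have := chi_abs R d; rewrite ler_norml => /andP[_ h] /=; nra.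
- have cd : chi d = 0 by rewrite dpk chiX cp expr0n.
  have : ((3 %| d) || (13 %| d))%N by case/orP: dp => h; apply/orP; [left|right]; rewrite dpk dvdn_exp.
  by rewrite cd /=; case/orP => -> ; lra.
Qed.

Lemma good_mertens_le N : (17 <= N)%N ->
  \sum_(1 <= d < N.+1) goodR d * mangoldt R d / d%:R <= ln N%:R / 2 + 200.
Proof.
move=> N17; have N0 : (0 < N)%N by lia.
have h1 := mertens_le R N0; have := chi_mangoldt_sum_bound R N17.
rewrite ler_norml => /andP[_ h2].
apply: (@le_trans _ _ ((\sum_(1 <= d < N.+1) mangoldt R d / d%:R +
   \sum_(1 <= d < N.+1) (chi d)%:~R * (mangoldt R d / d%:R)) / 2)); last by lra.
rewrite -big_split /= mulr_suml; apply: ler_sum_nat => d /andP[d0 _].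
have d0R : 0 <= d%:R^-1 :> R by rewrite invr_ge0 ler0n.
apply: (le_trans (ler_wpM2r d0R (goodR_mangoldt_le d))).
by rewrite le_eqVlt; apply/orP; left; apply/eqP; ring.
Qed.

Lemma good_mertens_ge N : (17 <= N)%N ->
  ln N%:R / 2 - 200 <= \sum_(1 <= d < N.+1) goodR d * mangoldt R d / d%:R.
Proof.
move=> N17; have N0 : (0 < N)%N by lia.
have h1 := mertens_ge R N0; have := chi_mangoldt_sum_bound R N17.
rewrite ler_norml => /andP[h2 _].
have h3 := @sum_mangoldt_dvd_le 3 N isT; have h13 := @sum_mangoldt_dvd_le 13 N isT.
have l3 : ln 3%:R <= 3 :> R by rewrite ltW // ln_sublinear.
have l13 : ln 13%:R <= 13 :> R by rewrite ltW // ln_sublinear.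
(* The squares contribute little because [mangoldt (e ^ 2)] is at most [2 ln e]. *)
have hs : \sum_(1 <= d < N.+1) (\sum_(1 <= e < N.+1) (if (e ^ 2 == d)%N then mangoldt R d else 0)) / d%:R <= 4 :> R.
  under eq_bigr do rewrite mulr_suml.
  rewrite exchange_big_nat /=.
  apply: (@le_trans _ _ (\sum_(1 <= e < N.+1) 2 * (ln e%:R / (e ^ 2)%:R))); last first.
    by rewrite -mulr_sumr; have := sum_ln_sqr_le N; lra.
  apply: ler_sum_nat => e /andP[e0 _].
  apply: (@le_trans _ _ (\sum_(1 <= d < N.+1 | d == (e ^ 2)%N) mangoldt R d / d%:R)).
    rewrite [X in _ <= X]big_mkcond /=; apply: ler_sum => d _.
    by rewrite eq_sym; case: eqP => // _; rewrite mul0r.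
  have pos : 0 <= 2 * (ln e%:R / (e ^ 2)%:R) :> R by rewrite !mulr_ge0 ?lnN_ge0 ?invr_ge0 ?ler0n.
  rewrite big_nat1_eq; case: ifP => // _.
  rewrite mulrA ler_wpM2r ?invr_ge0 ?ler0n //.
  apply: (le_trans (mangoldt_le_ln _ _)).
  by rewrite natrX lnXn ?ltr0n // -[_ *+ 2]mulr_natl.
apply: (@le_trans _ _ ((\sum_(1 <= d < N.+1) mangoldt R d / d%:R +
   \sum_(1 <= d < N.+1) (chi d)%:~R * (mangoldt R d / d%:R)) / 2
   - \sum_(1 <= d < N.+1) (\sum_(1 <= e < N.+1) (if (e ^ 2 == d)%N then mangoldt R d else 0)) / d%:R
   - \sum_(1 <= d < N.+1 | (3 %| d)%N) mangoldt R d / d%:R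
   - \sum_(1 <= d < N.+1 | (13 %| d)%N) mangoldt R d / d%:R)); first by lra.
rewrite -big_split /= mulr_suml.
rewrite [X in _ - X - _ <= _]big_mkcond [X in _ - X <= _]big_mkcond /= -!sumrB.
apply: ler_sum_nat => d /andP[d0]; rewrite ltnS => dN.
have d0R : 0 <= d%:R^-1 :> R by rewrite invr_ge0 ler0n.
have := ler_wpM2r d0R (goodR_mangoldt_ge dN); apply: le_trans.
rewrite le_eqVlt; apply/orP; left; apply/eqP.
by case: ifP => _; case: ifP => _; ring.
Qed.

Definition psig N : R := \sum_(1 <= d < N.+1) goodR d * mangoldt R d.

Lemma psig_ge0 N : 0 <= psig N.
Proof. by apply: sumr_ge0 => d _; rewrite mulr_ge0 ?goodR_ge0 ?mangoldt_ge0. Qed.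

(** The difference of the two Mertens estimates at [M] and [M %/ K] shows that the interval between
    them carries mass at least 1, and there [1 / d <= K / M]. *)
Lemma psig_ge : exists K M0 : nat, [/\ (0 < K)%N, (0 < M0)%N &
  forall M, (M0 <= M)%N -> M%:R <= K%:R * psig M].
Proof.
(* With [ln K >= 1000], half of [ln K] outweighs the two error terms of 200. *)
pose K := (Num.truncn (expR (1000 : R))).+1.
have K0 : (0 < K)%N by [].
have lnK : 1000 <= ln K%:R :> R.
  rewrite -(expRK (1000 : R)) ler_ln ?posrE ?expR_gt0 ?ltr0n //.
  by rewrite ltW // /K truncnS_gt // num_real.
exists K, (17 * K)%N; split=> // M hM.
have h17 : (17 <= M %/ K)%N by rewrite leq_divRL.
have M17 : (17 <= M)%N by rewrite (leq_trans h17) // leq_div.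
have M0 : 0 < M%:R :> R by rewrite ltr0n; lia.
have q0 : 0 < (M %/ K)%:R :> R by rewrite ltr0n; lia.
have h1 := good_mertens_le h17; have h2 := good_mertens_ge M17.
have hl : ln (M %/ K)%:R + 1000 <= ln M%:R :> R.
  apply: (le_trans (lerD (lexx _) lnK)).
  rewrite -lnM ?posrE // ?ltr0n // -natrM ler_lnN ?leq_divM //.
  by rewrite muln_gt0 K0 andbT; lia.
have : 1 <= \sum_((M %/ K).+1 <= d < M.+1) goodR d * mangoldt R d / d%:R.
  move: h2; rewrite (big_cat_nat _ (n := (M %/ K).+1)) //= ?ltnS ?leq_div //.
  by lra.
have : \sum_((M %/ K).+1 <= d < M.+1) goodR d * mangoldt R d / d%:R <= (K%:R / M%:R) * psig M.
  apply: (@le_trans _ _ (\sum_((M %/ K).+1 <= d < M.+1) K%:R / M%:R * (goodR d * mangoldt R d))).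
    apply: ler_sum_nat => d /andP[hd _]; rewrite mulrC ler_wpM2r ?mulr_ge0 ?goodR_ge0 ?mangoldt_ge0 //.
    have d0 : (0 < d)%N by lia.
    have M1 : (0 < M)%N by lia.
    rewrite -[X in _ <= X]invf_div lef_pV2 ?posrE ?divr_gt0 ?ltr0n //.
    apply: (le_trans (divn_natr_le R M K0)); rewrite natr1 ler_nat //.
  rewrite -mulr_sumr ler_wpM2l ?divr_ge0 ?ler0n //.
  rewrite /psig [X in _ <= X](big_cat_nat _ (n := (M %/ K).+1)) //= ?ltnS ?leq_div //.
  by rewrite lerDr sumr_ge0 // => d _; rewrite mulr_ge0 ?goodR_ge0 ?mangoldt_ge0.
move=> a b; have := le_trans b a.
by rewrite mulrAC ler_pdivlMr // mul1r.
Qed.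

End GoodPrimes.

(** * The convolution of 1 and the character *)

Section IdealCount.
Implicit Types (n d p k N : nat).

(* The number of ideals of norm [n] of the ring of integers of Q(sqrt 13) when
   [n] is prime to 3. *)
Definition rchi n : int := \sum_(d <- divisors n) chi d.

(** A divisor [d] corresponds to the pair of [gcdn d a] and [gcdn d b]; this yields the
    multiplicativity of [rchi]. *)
Lemma divisorsM_perm a b : (0 < a)%N -> (0 < b)%N -> coprime a b ->
  perm_eq (divisors (a * b)) [seq (x * y)%N | x <- divisors a, y <- divisors b].
Proof.
move=> a0 b0 cab; have ab0 : (0 < a * b)%N by rewrite muln_gt0 a0.
apply: uniq_perm; first exact: divisors_uniq.
  apply: allpairs_uniq; rewrite ?divisors_uniq //.
  move=> w1 w2 /allpairsP[[x y] /= [xa yb ->]].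
  move=> /allpairsP[[x' y'] /= [xa' yb' ->]] /= e.
  move: xa yb xa' yb'; rewrite -!dvdn_divisors // => xa yb xa' yb'.
  have gE u v : (u %| a)%N -> (v %| b)%N -> gcdn (u * v) a = u.
    move=> ua vb; have cva : coprime v a by rewrite coprime_sym (coprime_dvdr vb).
    by rewrite gcdnC Gauss_gcdl 1?coprime_sym // gcdnC; apply/gcdn_idPl.
  have ex : x = x' by rewrite -(gE x y) // e gE.
  have x0 : (0 < x)%N by apply: dvdn_gt0 xa.
  by move/eqP: e; rewrite -ex eqn_pmul2l // => /eqP ->.
move=> d; rewrite -dvdn_divisors //; apply/idP/allpairsP => [dab|[[x y] /= [xa yb ->]]].
  exists (gcdn d a, gcdn d b) => /=; rewrite -!dvdn_divisors // !dvdn_gcdr.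
  split=> //; apply/eqP; rewrite eqn_dvd; apply/andP; split.
    by rewrite muln_gcdl dvdn_gcd dvdn_mulr //= muln_gcdr dvdn_gcd dvdn_mull.
  rewrite Gauss_dvd ?dvdn_gcdl // (coprime_dvdl (dvdn_gcdr _ _)) //.
  by rewrite (coprime_dvdr (dvdn_gcdr _ _)).
by rewrite dvdn_mul // dvdn_divisors.
Qed.

Lemma rchiM a b : (0 < a)%N -> (0 < b)%N -> coprime a b -> rchi (a * b) = rchi a * rchi b.
Proof.
move=> a0 b0 cab; rewrite /rchi (perm_big _ (divisorsM_perm a0 b0 cab)) /=.
rewrite big_allpairs_dep /= mulr_suml; apply: eq_bigr => x _.
by rewrite mulr_sumr; apply: eq_bigr => y _; rewrite chiM.
Qed.

Lemma rchi_pow p k : prime p -> rchi (p ^ k) = \sum_(i < k.+1) chi p ^+ i.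
Proof.
move=> p_pr; have p0 := prime_gt0 p_pr; have p1 := prime_gt1 p_pr.
have e : perm_eq (divisors (p ^ k)) [seq (p ^ i)%N | i <- iota 0 k.+1].
  apply: uniq_perm; first exact: divisors_uniq.
    by rewrite map_inj_uniq ?iota_uniq // => i j /eqP; rewrite eqn_exp2l // => /eqP.
  move=> d; rewrite -dvdn_divisors ?expn_gt0 ?p0 //; apply/idP/mapP.
    by case/(dvdn_pfactor _ _ p_pr) => i ik ->; exists i; rewrite ?mem_iota.
  by case=> i; rewrite mem_iota => ik ->; rewrite dvdn_exp2l.
rewrite /rchi (perm_big _ e) big_map -[iota 0 k.+1]/(index_iota 0 k.+1) big_mkord.
by apply: eq_bigr => i _; rewrite chiX.
Qed.

Lemma geom_m1 k : \sum_(i < k.+1) (-1 : int) ^+ i = (~~ odd k)%:R.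
Proof.
elim: k => [|k IH]; first by rewrite big_ord1.
by rewrite big_ord_recr /= IH -signr_odd /=; case: (odd k).
Qed.

Lemma geom_0 k : \sum_(i < k.+1) (0 : int) ^+ i = 1.
Proof. by rewrite big_ord_recl big1 ?addr0 // => i _; rewrite expr0n. Qed.

(** Primes with [chi p = -1] occur to an even power; [t] collects those of 3 and 13 that occur to an
    odd power. *)
Definition badpart_shape n := exists t s : nat, [/\ (t %| 39)%N, (0 < s)%N & n = (t * s ^ 2)%N].

(** By multiplicativity: a power of a prime with [chi p = -1] contributes an alternating sum, 0 for
    odd and 1 for even exponents, and a power of 3 or 13 contributes 1. *)
Lemma rchi_bad n : (0 < n)%N -> (forall p, prime p -> (p %| n)%N -> chi p != 1) ->
  rchi n = 0 \/ (rchi n = 1 /\ badpart_shape n).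
Proof.
elim/ltn_ind: n => n IH n0 bad.
have [n1|n1] := leqP n 1.
  have -> : n = 1%N by lia.
  by right; split; [rewrite /rchi big_seq1|exists 1%N, 1%N].
have p_pr := pdiv_prime n1; set p := pdiv n in p_pr.
have pn : (p %| n)%N by exact: pdiv_dvd.
pose e := logn p n; pose m := (n %/ p ^ e)%N.
have e0 : (0 < e)%N by rewrite logn_gt0 mem_primes p_pr n0.
have en : n = (p ^ e * m)%N by rewrite mulnC divnK // pfactor_dvdnn.
have m0 : (0 < m)%N by case: (posnP m) en n0 => // ->; rewrite muln0 => ->.
have pe0 : (0 < p ^ e)%N by rewrite expn_gt0 prime_gt0.
have cm : coprime (p ^ e) m.
  rewrite coprime_pexpl // prime_coprime // -(expn1 p) pfactor_dvdn // -ltnNge.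
  have := congr1 (logn p) en; rewrite lognM // pfactorK // -/e; lia.
have pe1 : (1 < p ^ e)%N by rewrite -(exp1n e) ltn_exp2r // prime_gt1.
have mn : (m < n)%N by rewrite en ltn_Pmull.
have badm q : prime q -> (q %| m)%N -> chi q != 1.
  by move=> q_pr qm; apply: bad; rewrite // en dvdn_mull.
have rn : rchi n = rchi (p ^ e) * rchi m by rewrite {1}en rchiM.
case: (IH m mn m0 badm) => [rm|[rm [t [s [t39 s0 mE]]]]].
  by left; rewrite rn rm mulr0.
have re : rchi n = rchi (p ^ e) by rewrite rn rm mulr1.
rewrite re rchi_pow //.
have eE := odd_double_half e.
case: (chi_values p) => [cp|cp|[cp dp]]; first by have := bad p p_pr pn; rewrite cp.
- rewrite cp geom_m1; case: (boolP (odd e)) => oe; first by left.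
  right; split=> //; exists t, (p ^ e./2 * s)%N; split=> //.
    by rewrite muln_gt0 expn_gt0 prime_gt0.
  by rewrite {1}en mE expnMn -expnM muln2 -{1}eE (negbTE oe) add0n mulnCA.
- rewrite cp geom_0; right; split=> //.
  have p39 : (p %| 39)%N.
    by case/orP: dp => h; [rewrite (dvdn_trans (n := 3)) //|rewrite (dvdn_trans (n := 13)) //];
    rewrite dvdn_prime2 // eq_sym -dvdn_prime2.
  case: (boolP (odd e)) => oe.
    (* The leftover factor [p] joins [t]; the two are coprime because [t] divides [m]. *)
    exists (p * t)%N, (p ^ e./2 * s)%N; split.
    + rewrite Gauss_dvd ?p39 ?t39 //.
      move: cm; rewrite coprime_pexpl // mE => cm.
      by apply: (coprime_dvdr _ cm); rewrite dvdn_mulr.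
    + by rewrite muln_gt0 expn_gt0 prime_gt0.
    have pe : (p ^ e = p * (p ^ e./2) ^ 2)%N by rewrite -[in LHS]eE oe add1n [in LHS]expnS -expnM muln2.
    by rewrite {1}en mE pe; ring.
  exists t, (p ^ e./2 * s)%N; split=> //.
    by rewrite muln_gt0 expn_gt0 prime_gt0.
  by rewrite {1}en mE expnMn -expnM muln2 -{1}eE (negbTE oe) add0n mulnCA.
Qed.

Lemma rchi_good n : good n -> rchi n = (size (divisors n))%:R.
Proof.
move=> gn; have n0 := good_gt0 gn.
rewrite /rchi (eq_big_seq (fun=> 1)) => [|d]; first by rewrite big_const_seq count_predT -Monoid.iteropE.
rewrite -dvdn_divisors // => dn; apply: good_chi.
by move: gn; rewrite -(divnK dn) goodM => /andP[].
Qed.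

Lemma good_decomp n : (0 < n)%N -> exists g b : nat, [/\ n = (g * b)%N, good g, (0 < b)%N,
  coprime g b & forall p, prime p -> (p %| b)%N -> chi p != 1].
Proof.
move=> n0; pose gp : nat_pred := [pred p | chi p == 1].
exists (partn n gp), (partn n (negn gp)); split.
- by rewrite partnC.
- by have := part_pnat gp n.
- exact: part_gt0.
- exact: coprime_partC.
move=> p p_pr pb; have /pnatP := part_pnat (negn gp) n.
by move=> /(_ (part_gt0 _ _)) /(_ p p_pr pb).
Qed.

End IdealCount.

(** * The harmonic sum over good integers *)

Section GoodHarmonic.
Variable R : realType.
Implicit Types (n d p k N : nat).

Definition Fgood N : R := \sum_(1 <= n < N.+1) goodR R n / n%:R.

Lemma Fgood_ge0 N : 0 <= Fgood N.
Proof. by apply: sumr_ge0 => n _; rewrite divr_ge0 ?goodR_ge0 ?ler0n. Qed.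

(** Counts the representations [n = t s^2] with [s <= N]; it dominates the indicator of
    [badpart_shape] and is easy to sum over [n]. *)
Definition shapeR N n : R :=
  \sum_(t <- divisors 39) \sum_(1 <= s < N.+1) ((t * s ^ 2 == n)%N)%:R.

Lemma shapeR_ge0 N n : 0 <= shapeR N n.
Proof. by apply: sumr_ge0 => t _; apply: sumr_ge0 => s _; exact: ler0n. Qed.

Lemma shapeR_ge1 N n : (0 < n <= N)%N -> badpart_shape n -> 1 <= shapeR N n.
Proof.
move=> /andP[n0 nN] [t [s [t39 s0 nE]]].
have t0 : (0 < t)%N by apply: dvdn_gt0 t39.
have sN : (s <= N)%N.
  rewrite (leq_trans _ nN) // nE -mulnn (leq_trans (leq_pmulr s s0)) //.
  exact: leq_pmull.
rewrite /shapeR (bigD1_seq t) ?divisors_uniq -?dvdn_divisors //=.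
rewrite (bigD1_seq s) ?iota_uniq ?mem_index_iota ?s0 ?ltnS //= nE eqxx -addrA lerDl.
by rewrite addr_ge0 ?sumr_ge0 // => i _; rewrite ?ler0n // sumr_ge0.
Qed.

Lemma sum_inv_sqr_le N : \sum_(1 <= s < N.+1) ((s ^ 2)%:R)^-1 <= 2 :> R.
Proof.
have H M : \sum_(1 <= s < M.+2) ((s ^ 2)%:R)^-1 <= 2 - M.+1%:R^-1 :> R.
  elim: M => [|M IH]; first by rewrite big_nat1; lra.
  rewrite big_nat_recr //=.
  have x0 : 0 < M.+1%:R :> R by rewrite ltr0n.
  have : ((M.+2 ^ 2)%:R)^-1 <= M.+1%:R^-1 - M.+2%:R^-1 :> R.
    have -> : M.+1%:R^-1 - M.+2%:R^-1 = (M.+1%:R * M.+2%:R)^-1 :> R.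
      rewrite -[M.+2%:R]natr1; move: (M.+1%:R) x0 => x x0.
      have x1 : 0 < x + 1 by lra.
      by field; rewrite !gt_eqF.
    rewrite -natrM lef_pV2 ?posrE ?ltr0n ?ler_nat //.
    by rewrite -mulnn leq_pmul2r.
  by move: (M.+1%:R^-1) (M.+2%:R^-1) ((M.+2 ^ 2)%:R^-1) (\sum_(_ <= _ < _) _) IH => a b c d; lra.
case: N => [|N]; first by rewrite big_geq.
by apply: (le_trans (H N)); rewrite gerBl invr_ge0 ler0n.
Qed.

Lemma sum_shapeR_le N : \sum_(1 <= n < N.+1) shapeR N n / n%:R <= 8 :> R.
Proof.
rewrite /shapeR; under eq_bigr do rewrite mulr_suml.
rewrite exchange_big /=.
(* 39 has four divisors, each accounting for at most the sum of [1 / s^2]. *)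
apply: (@le_trans _ _ (\sum_(t <- divisors 39) 2)); last first.
  by rewrite big_const_seq count_predT /= ; lra.
rewrite big_seq [X in _ <= X]big_seq; apply: ler_sum => t; rewrite -dvdn_divisors // => t39.
have t0 : (0 < t)%N by apply: dvdn_gt0 t39.
under eq_bigr do rewrite mulr_suml.
rewrite exchange_big /=; apply: (le_trans _ (sum_inv_sqr_le N)).
apply: ler_sum_nat => s /andP[s0 _].
have pos : 0 <= ((s ^ 2)%:R)^-1 :> R by rewrite invr_ge0 ler0n.
apply: (@le_trans _ _ (\sum_(1 <= n < N.+1 | n == (t * s ^ 2)%N) n%:R^-1)).
  rewrite [X in _ <= X]big_mkcond /=; apply: ler_sum => n _.
  by rewrite eq_sym; case: eqP => _; rewrite ?mul1r ?mul0r.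
rewrite big_nat1_eq; case: ifP => // _.
by rewrite lef_pV2 ?posrE ?ltr0n ?muln_gt0 ?expn_gt0 ?t0 ?s0 // ler_nat leq_pmull.
Qed.

(** At a good [g], [rchi g] counts the factorizations [g = d e], whose factors are good, so the left
    side is the part of the square with [d e <= N]. *)
Lemma sum_good_rchi_le N :
  \sum_(1 <= g < N.+1) goodR R g * (rchi g)%:~R / g%:R <= Fgood N ^+ 2.
Proof.
pose F d e : R := (goodR R d / d%:R) * (goodR R e / e%:R).
have F0 d e : 0 <= F d e by rewrite !mulr_ge0 ?goodR_ge0 ?invr_ge0 ?ler0n.
have -> : \sum_(1 <= g < N.+1) goodR R g * (rchi g)%:~R / g%:R =
    \sum_(1 <= g < N.+1) \sum_(1 <= d < g.+1 | (d %| g)%N) F d (g %/ d)%N.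
  apply: eq_big_nat => g /andP[g0 _]; rewrite sum_divisors_seq //.
  have FE d : (d %| g)%N -> F d (g %/ d)%N = goodR R g / g%:R.
    move=> dg; rewrite /F mulrACA -goodRM -invfM -natrM.
    by rewrite [(d * _)%N]mulnC divnK.
  rewrite (eq_big_seq (fun=> goodR R g / g%:R)) => [|d]; last first.
    by rewrite -dvdn_divisors // => /FE.
  rewrite big_const_seq count_predT iter_addr_0 -[RHS]mulr_natr mulrAC.
  have [gg|] := boolP (good g); last by rewrite /goodR => /negbTE->; rewrite !mul0r.
  by rewrite rchi_good // rmorph_nat.
rewrite sum_divisor_exchange expr2 /Fgood mulr_suml; apply: ler_sum_nat => d /andP[d0 _].
rewrite mulr_sumr [X in _ <= X](big_cat_nat _ (n := (N %/ d).+1)) //= ?ltnS ?leq_div //.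
by rewrite lerDl sumr_ge0 // => e _; exact: F0.
Qed.

(** Each [n] splits into a good part and a coprime part free of good primes. On the latter [rchi] is
    at most [shapeR], whose harmonic sum is at most 8. *)
Lemma sum_rchi_le N : \sum_(1 <= n < N.+1) (rchi n)%:~R / n%:R <= 8 * Fgood N ^+ 2.
Proof.
pose F g b : R := (goodR R g * (rchi g)%:~R / g%:R) * (shapeR N b / b%:R).
have rg0 g : 0 <= goodR R g * (rchi g)%:~R / g%:R :> R.
  rewrite /goodR; case: (boolP (good g)) => [/rchi_good->|_]; last by rewrite !mul0r.
  by rewrite mul1r rmorph_nat divr_ge0.
have sh0 b : 0 <= shapeR N b / b%:R by rewrite divr_ge0 ?shapeR_ge0.
have F0 g b : 0 <= F g b by rewrite mulr_ge0.
apply: (@le_trans _ _ (\sum_(1 <= n < N.+1) \sum_(1 <= g < n.+1 | (g %| n)%N) F g (n %/ g)%N)).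
  apply: ler_sum_nat => n /andP[n0 nN]; rewrite sum_divisors_seq //.
  have [g [b [nE gg b0 cgb bad]]] := good_decomp n0.
  have g0 := good_gt0 gg.
  have gn : (g %| n)%N by rewrite nE dvdn_mulr.
  rewrite (bigD1_seq g) ?divisors_uniq -?dvdn_divisors //=.
  have nb : (n %/ g = b)%N by rewrite nE mulKn.
  rewrite nb; apply: (@le_trans _ _ (F g b)); last by rewrite lerDl sumr_ge0.
  rewrite nE rchiM //; case: (rchi_bad b0 bad) => [->|[-> sb]].
    by rewrite mulr0 mul0r.
  have bN : (0 < b <= N)%N.
    by rewrite b0 (leq_trans _ (nN : (n <= N)%N)) // nE leq_pmull.
  rewrite mulr1 /F /goodR gg mul1r natrM invfM [X in X <= _]mulrA ler_wpM2l //.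
    by rewrite rchi_good // rmorph_nat divr_ge0.
  by rewrite -[X in X <= _]mul1r ler_wpM2r ?invr_ge0 // shapeR_ge1.
rewrite sum_divisor_exchange.
apply: (@le_trans _ _ (\sum_(1 <= g < N.+1) (goodR R g * (rchi g)%:~R / g%:R) * 8)).
  apply: ler_sum_nat => g /andP[g0 _]; rewrite -mulr_sumr ler_wpM2l //.
  apply: (le_trans _ (sum_shapeR_le N)).
  rewrite [X in _ <= X](big_cat_nat _ (n := (N %/ g).+1)) //= ?ltnS ?leq_div //.
  by rewrite lerDl sumr_ge0.
rewrite -mulr_suml mulrC ler_wpM2l //; exact: sum_good_rchi_le.
Qed.

Lemma sum_inv_ge_ln N : ln N.+1%:R <= \sum_(1 <= n < N.+1) n%:R^-1 :> R.
Proof.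
elim: N => [|N IH]; first by rewrite big_geq // ln1.
rewrite big_nat_recr //=; have := lnS_le R (isT : 0 < N.+1)%N.
by move: (N.+1%:R^-1) (\sum_(_ <= _ < _) _) IH => a b; lra.
Qed.

(** Grouped by the cofactor [e], the sum is that of [Achi (N %/ e) / e]. Putting [Achi N >= 1/4] in
    place of [Achi (N %/ e)] costs [4 / N] for each [e], hence 4 in all. *)
Lemma sum_rchi_ge N : (17 <= N)%N ->
  4^-1 * ln N%:R - 4 <= \sum_(1 <= n < N.+1) (rchi n)%:~R / n%:R :> R.
Proof.
move=> N17; have N0 : (0 < N)%N by lia.
have NR : 0 < N%:R :> R by rewrite ltr0n.
pose F d e : R := (chi d)%:~R / d%:R * e%:R^-1.
have -> : \sum_(1 <= n < N.+1) (rchi n)%:~R / n%:R =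
    \sum_(1 <= n < N.+1) \sum_(1 <= d < n.+1 | (d %| n)%N) F d (n %/ d)%N.
  apply: eq_big_nat => n /andP[n0 _]; rewrite sum_divisors_seq // /rchi.
  rewrite rmorph_sum /= mulr_suml; apply: eq_big_seq => d.
  rewrite -dvdn_divisors // => dn; rewrite /F -mulrA -invfM -natrM mulnC divnK //.
rewrite sum_divisor_exchange sum_hyperbola_sym.
have -> : \sum_(1 <= e < N.+1) \sum_(1 <= d < (N %/ e).+1) F d e =
    \sum_(1 <= e < N.+1) e%:R^-1 * Achi R (N %/ e).
  by apply: eq_bigr => e _; rewrite -mulr_suml mulrC.
apply: (@le_trans _ _ (\sum_(1 <= e < N.+1) (e%:R^-1 * Achi R N - 4 / N%:R))); last first.
  apply: ler_sum_nat => e /andP[e0 _].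
  have := Achi_div_diff R e0 N0; rewrite ler_norml => /andP[h _].
  have e0R : 0 < e%:R :> R by rewrite ltr0n.
  have := ler_wpM2l (ltW (_ : 0 < e%:R^-1)) h; rewrite invr_gt0 => /(_ e0R).
  have -> : e%:R^-1 * - (4 * e%:R / N%:R) = - (4 / N%:R) :> R.
    by field; rewrite !gt_eqF.
  by rewrite mulrBr; lra.
rewrite sumrB sumr_const_nat subn1 /= -[(4 / _) *+ N]mulr_natr mulfVK ?gt_eqF // -mulr_suml lerD2r.
have A4 := Achi_ge R N17.
have h : ln N%:R <= \sum_(1 <= n < N.+1) n%:R^-1 :> R.
  by apply: le_trans (sum_inv_ge_ln N); rewrite ler_lnN.
rewrite mulrC ler_pM ?lnN_ge0 //.
Qed.

(** The two estimates give [8 F^2 >= ln N / 4 - 4], which is at least [ln N / 8] once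
    [ln N >= 32]. *)
Lemma Fgood_ge N : (17 <= N)%N -> 32 <= ln N%:R :> R ->
  Num.sqrt (ln N%:R) / 8 <= Fgood N.
Proof.
move=> N17 l32; rewrite -(ler_pXn2r (n := 2)) ?nnegrE ?Fgood_ge0 ?divr_ge0 ?sqrtr_ge0 //.
rewrite exprMn sqr_sqrtr ?lnN_ge0 //.
have := sum_rchi_ge N17; have := sum_rchi_le N.
rewrite exprVn (_ : 8 ^+ 2 = 64); last by rewrite -natrX.
by lra.
Qed.

End GoodHarmonic.

(** * Lower bound for the number of good integers *)

Section GoodCount.
Variable R : realType.
Implicit Types (n d p k N : nat).

Lemma ln_nat_unbounded (x : R) : exists n, (0 < n)%N /\ forall N, (n <= N)%N -> x <= ln N%:R.
Proof.
exists (Num.truncn (expR x)).+1; split=> // N h.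
apply: (@le_trans _ _ (ln (Num.truncn (expR x)).+1%:R)); last by rewrite ler_lnN.
rewrite -{1}(expRK x) ler_ln ?posrE ?expR_gt0 ?ltr0n //.
by rewrite ltW // truncnS_gt // num_real.
Qed.

Lemma good_ln_sum_ge N : \sum_(1 <= e < N.+1) goodR R e * psig R (N %/ e) <=
  (\sum_(1 <= n < N.+1) goodR R n) * ln N%:R.
Proof.
apply: (@le_trans _ _ (\sum_(1 <= n < N.+1) goodR R n * ln n%:R)); last first.
  rewrite mulr_suml; apply: ler_sum_nat => n /andP[n0 nN].
  by rewrite ler_wpM2l ?goodR_ge0 // ler_lnN.
rewrite (sum_cmult_ln N (@goodRM R)).
under [X in _ <= X]eq_bigr do rewrite mulr_sumr.
rewrite [X in _ <= X]sum_hyperbola_sym.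
apply: ler_sum => e _; rewrite /psig mulr_sumr.
by apply: ler_sum => d _; rewrite mulrC.
Qed.

(** For [e <= q = N %/ M0], [psig (N %/ e)] is at least [N / (2 K e)], so the sum of logarithms of
    good integers is at least [N / (2 K)] times [Fgood q]. *)
Lemma good_count_ge : exists (c : R) (N1 : nat), 0 < c /\ forall N, (N1 <= N)%N ->
  c * (N%:R / Num.sqrt (ln N%:R)) <= \sum_(1 <= n < N.+1) goodR R n.
Proof.
have [K [M0 [K0 M00 hK]]] := psig_ge R.
have [E [E0 hE]] := ln_nat_unbounded 64.
have KR : 0 < K%:R :> R by rewrite ltr0n.
(* The term [2 * M0 ^ 2] ensures [N <= q ^ 2], and [E] ensures [ln N >= 64], so that
   [ln q >= 32]. *)
exists (32 * K%:R)^-1, (2 * M0 ^ 2 + E)%N; split; first by rewrite invr_gt0 mulr_gt0.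
move=> N hN.
have lN : 64 <= ln N%:R :> R by apply: hE; lia.
have N0 : (0 < N)%N by lia.
have NR : 0 < N%:R :> R by rewrite ltr0n.
pose q := (N %/ M0)%N.
have q2 : (2 * M0 <= q)%N by rewrite leq_divRL // -mulnA mulnn; lia.
have qN : (N <= q ^ 2)%N.
  have : (N < q.+1 * M0)%N by rewrite -ltn_divLR.
  by move: q2; rewrite -mulnn; nia.
have q0 : (0 < q)%N by lia.
have lq : ln N%:R <= 2 * ln q%:R :> R.
  have := ler_lnN R N0 qN; rewrite natrX lnXn ?ltr0n // -[ln q%:R *+ 2]mulr_natl.
  by [].
have q17 : (17 <= q)%N.
  have h : ln q%:R < q%:R :> R by rewrite ln_sublinear // ltr0n.
  have : 17%:R < q%:R :> R by lra.
  by rewrite ltr_nat => /ltnW.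
have hF : Num.sqrt (ln q%:R) / 8 <= Fgood R q by apply: Fgood_ge => //; lra.
have S1 : N%:R / (2 * K%:R) * Fgood R q <= \sum_(1 <= e < N.+1) goodR R e * psig R (N %/ e).
  have qN' : (q <= N)%N by exact: leq_div.
  rewrite [X in _ <= X](big_cat_nat _ (n := q.+1)) //= -[X in X <= _]addr0; apply: lerD; last first.
    by apply: sumr_ge0 => e _; rewrite mulr_ge0 ?goodR_ge0 ?psig_ge0.
  rewrite /Fgood mulr_sumr; apply: ler_sum_nat => e /andP[e0 eq].
  have eM : (M0 <= N %/ e)%N.
    rewrite leq_divRL // mulnC -leq_divRL //.
  have h1 := hK _ eM; have h2 := divn_natr_le R N e0.
  have h3 : 1 <= (N %/ e)%:R :> R by rewrite ler1n (leq_trans M00).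
  have eR : 0 < e%:R :> R by rewrite ltr0n.
  rewrite mulrCA ler_wpM2l ?goodR_ge0 //.
  have -> : N%:R / (2 * K%:R) / e%:R = (N%:R / e%:R) / (2 * K%:R) :> R by rewrite mulrAC.
  rewrite ler_pdivrMr ?mulr_gt0 //.
  by move: (N%:R / e%:R) h2 => z h2; lra.
have S2 := le_trans S1 (good_ln_sum_ge N).
set S := \sum_(_ <= _ < _) _ in S2 *.
have sN : 0 < Num.sqrt (ln N%:R) :> R by rewrite sqrtr_gt0; lra.
have sq : Num.sqrt (ln N%:R) <= 2 * Num.sqrt (ln q%:R) :> R.
  rewrite -(ler_pXn2r (n := 2)) ?nnegrE ?mulr_ge0 ?sqrtr_ge0 //.
  by rewrite exprMn !sqr_sqrtr ?lnN_ge0 // (_ : 2 ^+ 2 = 4) ?natrX //; [lra|rewrite -natrX].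
have e2 : ln N%:R = Num.sqrt (ln N%:R) ^+ 2 :> R by rewrite sqr_sqrtr ?lnN_ge0.
rewrite {1}e2 in S2.
set s := Num.sqrt (ln N%:R) in S2 sq sN *.
have h16 : s / 16 <= Fgood R q by lra.
have h4 : N%:R / (2 * K%:R) * (s / 16) <= S * s ^+ 2.
  by apply: (le_trans _ S2); rewrite ler_wpM2l // divr_ge0 ?mulr_ge0 ?ler0n.
have e3 : (32 * K%:R)^-1 * (N%:R / s) = N%:R / (2 * K%:R) * (s / 16) / s ^+ 2.
  have K0' : K%:R != 0 :> R by rewrite gt_eqF.
  have s0' : s != 0 by rewrite gt_eqF.
  by field; rewrite s0' K0'.
by rewrite e3 ler_pdivrMr // exprn_gt0.
Qed.

End GoodCount.

(** * Semi-integral points *)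

(** What remains of the surface equation at the point with coordinates 11, [x / d], [y / d], up to
    the constant 121 and the denominator [d^2]. *)
Definition quadform11 (x y : int) : int := x ^+ 2 - 11 * x * y + y ^+ 2.

(* Multiplying by [omega ^ 2 = 3 + omega], where [omega] has norm -3 and is
   idempotent modulo 3, keeps the [omega]-coordinate prime to 3. *)
Lemma qnorm_pow9 (a b n : int) (j : nat) : qnorm a b = n -> ~~ (3 %| n)%Z ->
  exists c d : int, qnorm (3 * c) d = n * 9 ^+ j.+1 /\ ~~ (3 %| d)%Z.
Proof.
move=> ab n3; elim: j => [|j [c [d [e d3]]]].
  exists (a + b), (a + 4 * b); split; first by rewrite -ab /qnorm; ring.
  apply: contraNN n3 => /dvdzP[z hz].
  have aE : a = z * 3 - 4 * b by rewrite -hz; ring.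
  apply/dvdzP; exists (a * z - a * b - b ^+ 2).
  by rewrite -ab /qnorm aE; ring.
exists (3 * c + d), (3 * c + 4 * d); split.
  by rewrite exprS mulrCA -e /qnorm; ring.
apply: contraNN d3 => /dvdzP[z hz]; apply/dvdzP; exists (z - c - d).
by move: hz; lia.
Qed.

(** The substitution [x = 9 c - 4 d], [y = - d] turns the form into [9 * qnorm (3 * c) d]. One
    factor 9 comes from the substitution and at least one from [qnorm_pow9], whence [2 <= w]. *)
Lemma quadform11_repr (n : int) (w : nat) : (2 <= w)%N ->
  (exists a b, qnorm a b = n) -> ~~ (3 %| n)%Z ->
  exists x y : int, [/\ ~~ (3 %| x)%Z, ~~ (3 %| y)%Z &
    quadform11 x y = n * (3 ^+ w) ^+ 2].
Proof.
case: w => [|[|w]] // _ [a [b ab]] n3; have [c [d [e d3]]] := qnorm_pow9 w ab n3.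
exists (9 * c - 4 * d), (- d); split.
- by apply: contraNN d3 => /dvdzP[z hz]; apply/dvdzP; exists (3 * c - d - z); lia.
- by rewrite rpredN.
have -> : quadform11 (9 * c - 4 * d) (- d) = 9 * qnorm (3 * c) d.
  by rewrite /quadform11 /qnorm; ring.
by rewrite e -exprM mulnC exprM (_ : 3 ^+ 2 = 9) // [in RHS]exprS mulrCA.
Qed.

(** * Integers in Z_p and the obstruction at 3 *)

Lemma Zp_intr_eq0 (q : nat) (z : int) : (1 < q)%N -> (z%:~R == 0 :> 'Z_q) = (q%:Z %| z)%Z.
Proof.
move=> q1; have nat0 (n : nat) : (n%:R == 0 :> 'Z_q) = (q %| n)%N.
  by rewrite -val_eqE /= val_Zp_nat.
case: z => n; rewrite dvdzE; first by rewrite -pmulrn nat0.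
by rewrite NegzE rmorphN /= oppr_eq0 -pmulrn nat0.
Qed.

Lemma pres_natr (p : primeNat) (n k : nat) : (n%:R : padicInt p) k = n%:R.
Proof. by elim: n => [|n IH] //; rewrite -!natr1 -IH. Qed.

Lemma pres_intr (p : primeNat) (z : int) (k : nat) : (z%:~R : padicInt p) k = z%:~R.
Proof.
case: z => n; first by rewrite -!pmulrn pres_natr.
by rewrite NegzE !rmorphN /= -!pmulrn -(pres_natr p).
Qed.

Lemma padic_intr_eq0 (p : primeNat) (z : int) : (z%:~R == 0 :> padicInt p) = (z == 0).
Proof.
apply/eqP/eqP => [h|-> //].
have p1 := prime_gt1 (primeNatP p).
(* The component at level [|z|] lives modulo [p ^ (|z| + 1)], which exceeds [|z|]. *)
have : (z%:~R : padicInt p) `|z|%N = 0 by rewrite h.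
rewrite pres_intr => /eqP; rewrite Zp_intr_eq0 ?expp_gt1 // dvdzE => dv.
have [/eqP|z0] := posnP `|z|%N; first by rewrite absz_eq0 => /eqP.
by have := dvdn_leq z0 dv; have := ltn_expl `|z|.+1 p1; rewrite /=; lia.
Qed.

(** Bezout gives an inverse modulo each power of [p], and these inverses are compatible under
    reduction. *)
Lemma padic_intr_unit (p : primeNat) (z : int) : ~~ (p%:Z %| z)%Z ->
  (z%:~R : padicInt p) \is a GRing.unit.
Proof.
move=> pz; have p_pr := primeNatP p.
have U k : (z%:~R : Zpn p k) \is a GRing.unit.
  have cop : coprimez z (p%:Z ^+ k.+1).
    rewrite coprimez_sym coprimez_pexpl // /coprimez /gcdz /= -[_ == _]/(coprime _ _).
    by rewrite prime_coprime // -dvdzE.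
  have /coprimezP[[u v] /= uv] := cop.
  apply/unitrP; exists (u%:~R); rewrite -!rmorphM /= [z * u]mulrC.
  have -> : (u * z)%:~R = 1 :> Zpn p k; last by [].
  apply/eqP; rewrite -subr_eq0 -(rmorph1 intr) -rmorphB /= Zp_intr_eq0 ?expp_gt1 //.
  rewrite -uv opprD addrA subrr sub0r rpredN.
  by apply: dvdz_mull; rewrite -!natz natrX.
have cmp k : Zpn_red ((z%:~R : Zpn p k.+1)^-1) = (z%:~R : Zpn p k)^-1.
  by rewrite rmorphV ?U //= rmorph_int.
pose y : padicInt p := @PadicInt p (fun k => (z%:~R : Zpn p k)^-1) cmp.
apply/unitrP; exists y.
have e : y * z%:~R = 1.
  apply: padicInt_eq => k; rewrite -[LHS]/(y k * (z%:~R : padicInt p) k) pres_intr.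
  exact: (mulVr (U k)).
by split=> //; rewrite mulrC.
Qed.

(** Evaluation over all triples of residues modulo 9, for both classes of [m]. *)
Lemma markoff_mod9 (a b c : nat) (m : int) : (a < 9)%N -> (b < 9)%N -> (c < 9)%N ->
  (9 %| m - 3)%Z || (9 %| m - 6)%Z ->
  ~~ (9 %| a%:Z * a%:Z + (b%:Z * b%:Z + c%:Z * c%:Z) - a%:Z * (b%:Z * c%:Z) - m)%Z.
Proof.
move=> ha hb hc hm.
pose F (r : int) (a b c : nat) :=
  ~~ (9 %| a%:Z * a%:Z + (b%:Z * b%:Z + c%:Z * c%:Z) - a%:Z * (b%:Z * c%:Z) - r)%Z.
have H : all (fun a => all (fun b => all (fun c => F 3 a b c && F 6 a b c)
  (iota 0 9)) (iota 0 9)) (iota 0 9) by vm_compute.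
have /andP[F3 F6] : F 3 a b c && F 6 a b c.
  move/allP: H => /(_ a); rewrite mem_iota => /(_ ha)/allP/(_ b).
  by rewrite mem_iota => /(_ hb)/allP/(_ c); rewrite mem_iota => /(_ hc).
case/orP: hm => hm; [apply: contraNN F3|apply: contraNN F6] => hd.
- by have := rpredD hd hm; rewrite addrA subrK.
- by have := rpredD hd hm; rewrite addrA subrK.
Qed.

Lemma Uadelic_empty (R : realType) (m : int) :
  (9 %| m - 3)%Z || (9 %| m - 6)%Z -> @Uadelic R m = set0.
Proof.
move=> hm; rewrite -subset0 => v [_ /(_ (@PrimeNat 3 isT))].
move: (v.2 _) => u; rewrite /Upts /= !big_ord_recl !big_ord0 !addr0 !mulr1.
move: (u _) (u _) (u _) => z y x E.
have E1 : x 1%N * x 1%N + (y 1%N * y 1%N + z 1%N * z 1%N) - x 1%N * (y 1%N * z 1%N) = m%:~R.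
  by rewrite -(pres_intr (@PrimeNat 3 isT) m 1) -E.
have natE (t : Zpn (@PrimeNat 3 isT) 1) : t = (t : nat)%:Z%:~R by rewrite -pmulrn natr_Zp.
have t9 (t : Zpn (@PrimeNat 3 isT) 1) : (t < 9)%N by exact: ltn_ord.
have /negP := markoff_mod9 (t9 (x 1%N)) (t9 (y 1%N)) (t9 (z 1%N)) hm; apply.
rewrite -(@Zp_intr_eq0 9) // !rmorphB !rmorphD !rmorphM /=.
by rewrite -!natE subr_eq0; apply/eqP.
Qed.

(** [ratr] is computed from the reduced numerator and denominator; cross-multiplication in
    characteristic 0 extends it to any fraction. *)
Lemma ratr_quot (F : fieldType) (charF : forall n : nat, n.+1%:R != 0 :> F) (a b : int) :
  b != 0 -> ratr (a%:~R / b%:~R : rat) = a%:~R / b%:~R :> F.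
Proof.
move=> b0; set q : rat := _ / _.
have int0 (z : int) : z != 0 -> z%:~R != 0 :> F.
  case: z => [[|n]|n] //= _; first by rewrite -pmulrn.
  by rewrite NegzE rmorphN oppr_eq0 /= -pmulrn.
rewrite /ratr; apply/eqP; rewrite eqr_div ?int0 ?denq_neq0 //.
rewrite -!rmorphM /=; apply/eqP; congr (_%:~R).
apply: (intr_inj (R := rat)); rewrite !rmorphM /= numqE /q.
by rewrite mulrAC divfK // intr_eq0.
Qed.

(** * The rational point and its local extensions *)

Section Point.
Variables (i0 : 'I_3).

(** Puts [a] at [i0], [b] at the cyclically next index and [c] at the third, so that one computation
    covers each choice of [i0]. *)
Definition triple (T : Type) (a b c : T) (i : 'I_3) : T :=
  if i == i0 :> nat then a else if i == (i0.+1 %% 3)%N :> nat then b else c.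

Lemma sum_triple (T : Type) (A : comNzRingType) (g : T -> A) a b c :
  \sum_(i < 3) g (triple a b c i) = g a + g b + g c.
Proof.
rewrite !big_ord_recl big_ord0 /triple.
by case: i0 => [[|[|[|//]]] h] /=; ring.
Qed.

Lemma prod_triple (T : Type) (A : comNzRingType) (g : T -> A) a b c :
  \prod_(i < 3) g (triple a b c i) = g a * g b * g c.
Proof.
rewrite !big_ord_recl big_ord0 /triple.
by case: i0 => [[|[|[|//]]] h] /=; ring.
Qed.

Lemma triple_hd (T : Type) (a b c : T) : triple a b c i0 = a.
Proof. by rewrite /triple eqxx. Qed.

Lemma triple_tl (T : Type) (a b c : T) i : i != i0 ->
  triple a b c i = b \/ triple a b c i = c.
Proof.
by move=> h; rewrite /triple -[(i : nat) == _]/(i == i0) (negbTE h); case: ifP; [left|right].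
Qed.

End Point.

Section Construction.
Variables (k : semiIntKind) (w : weights) (i0 : 'I_3) (w0 : nat).
Hypothesis wi0 : w i0 = Some w0.
Variables (n x y : int).
Hypotheses (x3 : ~~ (3 %| x)%Z) (y3 : ~~ (3 %| y)%Z)
  (xy : quadform11 x y = n * (3 ^+ w0) ^+ 2).

(** [Y] gives integral homogeneous coordinates of the point [u]. They are primitive at every prime:
    away from 3 because of [d], at 3 because of [x] and [y]. *)
Let d : int := 3 ^+ w0.
Let U := triple i0 (11 * d) x y.
Let Y (j : 'I_4) : int := if unlift ord0 j is Some i then U i else d.
Let u (i : 'I_3) : rat := (U i)%:~R / d%:~R.

Lemma denom_neq0 : d != 0. Proof. by rewrite expf_neq0. Qed.

Lemma affineEmb_quot j : affineEmb u j = (Y j)%:~R / d%:~R.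
Proof.
rewrite /affineEmb /Y; case: unlift => // .
by rewrite divff // intr_eq0 denom_neq0.
Qed.

Lemma Upts_u : Upts (121 + n) u.
Proof.
have d0 : d%:~R != 0 :> rat by rewrite intr_eq0 denom_neq0.
rewrite /Upts /= /u (sum_triple i0 (fun z : int => (z%:~R / d%:~R) ^+ 2)).
rewrite (prod_triple i0 (fun z : int => z%:~R / d%:~R)).
have qE : (quadform11 x y)%:~R = x%:~R ^+ 2 - 11 * x%:~R * y%:~R + y%:~R ^+ 2 :> rat.
  by rewrite /quadform11 rmorphD rmorphB !rmorphXn !rmorphM.
have E : (quadform11 x y)%:~R = n%:~R * d%:~R ^+ 2 :> rat.
  by rewrite xy rmorphM rmorphXn.
have nE : n%:~R = (quadform11 x y)%:~R / d%:~R ^+ 2 :> rat.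
  by rewrite E mulfK // expf_neq0.
rewrite rmorphD /= nE qE rmorphM /=.
by field.
Qed.

Lemma Xeq_Y (A : comNzRingType) : Xeq (A := A) (121 + n) (fun j => (Y j)%:~R).
Proof.
rewrite /Xeq /Y unlift_none.
under eq_bigr do rewrite liftK; under [X in _ - X]eq_bigr do rewrite liftK.
rewrite (sum_triple i0 (fun z : int => (z%:~R : A) ^+ 2)).
rewrite (prod_triple i0 (fun z : int => (z%:~R : A))).
rewrite -!rmorphXn /= -!rmorphD /= -!rmorphM /= -rmorphB /=; congr (_%:~R).
have := xy; rewrite -/d /quadform11 => E.
have -> : (121 + n) * d ^+ 3 = 121 * d ^+ 3 + d * (n * d ^+ 2) by ring.
by rewrite -E; ring.
Qed.

Lemma Xrat_u : Xrat (121 + n) (affineEmb u).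
Proof.
split; first by exists ord0; rewrite /affineEmb unlift_none oner_neq0.
rewrite /Xeq /affineEmb unlift_none expr1n mulr1 mul1r.
under eq_bigr do rewrite liftK; under [X in _ - X]eq_bigr do rewrite liftK.
exact: Upts_u.
Qed.

Section AtPrime.
Variable p : primeNat.
Let yp (j : 'I_4) : padicInt p := (Y j)%:~R.

Lemma frac_char0 (m : nat) : m.+1%:R != 0 :> {fraction padicInt p}.
Proof.
rewrite -(rmorph_nat (@FracField.tofrac (padicInt p))) tofrac_eq0.
by rewrite pmulrn padic_intr_eq0.
Qed.

Lemma extends_u : extends (affineEmb u) yp.
Proof.
have td : d%:~R != 0 :> {fraction padicInt p}.
  by rewrite -(rmorph_int (@FracField.tofrac (padicInt p))) tofrac_eq0 padic_intr_eq0 denom_neq0.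
exists d%:~R => // j; rewrite affineEmb_quot (ratr_quot frac_char0) ?denom_neq0 //.
by rewrite /yp (rmorph_int (@FracField.tofrac (padicInt p))) mulrC divfK.
Qed.

Lemma bdIdeal_unit i : (yp ord0 \is a GRing.unit) || (yp (lift ord0 i) \is a GRing.unit) ->
  bdIdeal yp i = [set: padicInt p]%classic.
Proof.
move=> h; apply/seteqP; split=> // z _; rewrite /bdIdeal /=; case/orP: h => h.
  by exists (z / yp ord0), 0; rewrite divrK // mul0r addr0.
by exists 0, (z / yp (lift ord0 i)); rewrite divrK // mul0r add0r.
Qed.

Lemma pIdeal0 : @pIdeal p 0 = [set: padicInt p]%classic.
Proof. by apply/seteqP; split=> // z _; exists z; rewrite expr0 mulr1. Qed.

Lemma unit_ne3 : p != 3%N :> nat -> yp ord0 \is a GRing.unit.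
Proof.
move=> p3; apply: padic_intr_unit; rewrite /Y unlift_none /d dvdzE abszX Euclid_dvdX ?primeNatP //.
by rewrite dvdn_prime2 ?primeNatP // (negbTE p3).
Qed.

Lemma unit_tl i : i != i0 -> p = 3%N :> nat -> yp (lift ord0 i) \is a GRing.unit.
Proof.
move=> ii0 p3; apply: padic_intr_unit; rewrite /Y liftK p3 /U.
by case: (triple_tl (11 * d) x y ii0) => ->.
Qed.

Lemma bdIdeal_hd : p = 3%N :> nat -> bdIdeal yp i0 = @pIdeal p w0.
Proof.
move=> p3; have e : (p : nat)%:R ^+ w0 = yp ord0.
  by rewrite /yp /Y unlift_none /d rmorphXn /= p3.
have e' : yp (lift ord0 i0) = 11%:R * yp ord0.
  by rewrite /yp /Y liftK unlift_none /U triple_hd rmorphM.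
apply/seteqP; split=> z; rewrite /bdIdeal /pIdeal /= e e'.
  by case=> a [b ->]; exists (a + b * 11%:R); ring.
by case=> a ->; exists a, 0; ring.
Qed.

(** At 3 and [i0] the multiplicity is exactly [w0], which both notions allow. Everywhere else the
    ideal is the whole ring, which suits finite and infinite weights alike. *)
Lemma semiIntAt_u : semiIntAt k w yp.
Proof.
move=> i; have [p3|p3] := eqVneq (p : nat) 3%N.
  have [->|ii0] := eqVneq i i0.
    rewrite wi0; exists (Some w0); first exact: bdIdeal_hd.
    by rewrite /allowedMult; case: k => //; right.
  have e : bdIdeal yp i = [set: padicInt p]%classic by apply: bdIdeal_unit; rewrite unit_tl ?orbT.
  case: (w i) => // wi; exists (Some 0%N); first by rewrite /intMult e pIdeal0.
  by rewrite /allowedMult; case: k => //; left.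
have e : bdIdeal yp i = [set: padicInt p]%classic by apply: bdIdeal_unit; rewrite unit_ne3.
case: (w i) => // wi; exists (Some 0%N); first by rewrite /intMult e pIdeal0.
by rewrite /allowedMult; case: k => //; left.
Qed.

Lemma Xpadic_u : Xpadic (121 + n) yp.
Proof.
split; last exact: Xeq_Y.
have [p3|p3] := eqVneq (p : nat) 3%N; last by exists ord0; exact: unit_ne3.
have [i ii0] : exists i, i != i0.
  by case: i0 => [[|m] h]; [exists (lift ord0 ord0)|exists ord0].
by exists (lift ord0 i); exact: unit_tl.
Qed.

End AtPrime.

Lemma strSemiInt_u : strSemiInt k w (121 + n) u.
Proof.
split; first exact: Upts_u.
split; first exact: Xrat_u.
  by move=> i _ [/eqP]; rewrite /affineEmb unlift_none oner_eq0.
move=> p; eexists; split; [exact: Xpadic_u|exact: extends_u|exact: semiIntAt_u].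
Qed.

End Construction.

(** * From good integers to counted values of [m] *)

(* For [n] prime to 3, the sign and the factor 4 make [shift_of n] congruent to
   2 or 8 modulo 9, that is, [121 + shift_of n] to 3 or 6. *)
Definition shift_of (n : nat) : int :=
  if (n %% 9)%N \in [:: 2; 8]%N then n%:Z
  else if (n %% 9)%N \in [:: 1; 7]%N then - n%:Z
  else if (n %% 9)%N == 5%N then 4 * n%:Z else - (4 * n%:Z).

Lemma good_ndvd q n : good q = false -> good n -> ~~ (q %| n)%N.
Proof.
move=> gq; apply: contraL => /dvdnP[z ->]; by rewrite goodM gq andbF.
Qed.

Lemma shift_ofP n : [\/ shift_of n = n%:Z, shift_of n = - n%:Z,
  shift_of n = 4 * n%:Z | shift_of n = - (4 * n%:Z)].
Proof.
rewrite /shift_of; case: ifP => _; first by constructor 1.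
case: ifP => _; first by constructor 2.
by case: ifP => _; [constructor 3|constructor 4].
Qed.

Lemma shift_of_qnorm n : good n -> exists a b, qnorm a b = shift_of n.
Proof.
move=> /good_qnorm[a [b e]].
have e4 : qnorm (2 * a) (2 * b) = 4 * n%:Z by rewrite -e /qnorm; ring.
case: (shift_ofP n) => ->.
- by exists a, b.
- exact: qnorm_opp e.
- by exists (2 * a), (2 * b).
- exact: qnorm_opp e4.
Qed.

Lemma shift_of_ndvd3 n : good n -> ~~ (3 %| shift_of n)%Z.
Proof.
move=> gn; have n3 := @good_ndvd 3 n erefl gn.
by case: (shift_ofP n) => ->; lia.
Qed.

Lemma shift_of_mod9 n : good n ->
  (9 %| 121 + shift_of n - 3)%Z || (9 %| 121 + shift_of n - 6)%Z.
Proof.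
move=> gn; have n3 := @good_ndvd 3 n erefl gn; rewrite /shift_of.
have [e|[e|[e|[e|[e|e]]]]] : (n %% 9 = 1 \/ n %% 9 = 2 \/ n %% 9 = 4 \/
  n %% 9 = 5 \/ n %% 9 = 7 \/ n %% 9 = 8)%N by lia.
all: by rewrite e /=; lia.
Qed.

(** The sign of the value shows whether [n] was negated, and its parity whether it was multiplied by
    4, since good integers are odd. *)
Lemma shift_of_inj : {in good &, injective shift_of}.
Proof.
move=> m n gm gn; have om := @good_ndvd 2 m erefl gm; have on := @good_ndvd 2 n erefl gn.
have m0 := good_gt0 gm; have n0 := good_gt0 gn.
by case: (shift_ofP m) => ->; case: (shift_ofP n) => ->; lia.
Qed.

Lemma shift_of_le n N : (n <= N)%N -> (`|121 + shift_of n| <= 121 + 4 * N%:Z)%R.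
Proof. by move=> nN; case: (shift_ofP n) => ->; lia. Qed.

Lemma shift_of_counted (R : realType) k (w : weights) (B : R) (n N : nat) :
  (forall i n, w i = Some n -> (2 <= n)%N) -> (exists i, w i <> None) ->
  121 + 4 * N%:R <= B -> good n -> (n <= N)%N -> countedM k w B (121 + shift_of n).
Proof.
move=> w_ge2 [i0]; case wi0 : (w i0) => [w0|//] _ NB gn nN.
have w02 := w_ge2 _ _ wi0; have h9 := shift_of_mod9 gn.
have [x [y [x3 y3 xy]]] := quadform11_repr w02 (shift_of_qnorm gn) (shift_of_ndvd3 gn).
split.
- by move: h9; split; lia.
- apply: le_trans NB; rewrite -intr_norm.
  have -> : 121 + 4 * N%:R = (121 + 4 * N%:Z)%:~R :> R.
    by rewrite rmorphD rmorphM /= -pmulrn.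
  by rewrite ler_int shift_of_le.
- exact: Uadelic_empty.
- eexists; exact: (strSemiInt_u k wi0 x3 y3 xy).
Qed.

Lemma good_sum_le_countN (R : realType) k (w : weights) (B : R) (N : nat) :
  (forall i n, w i = Some n -> (2 <= n)%N) -> (exists i, w i <> None) ->
  121 + 4 * N%:R <= B -> \sum_(1 <= n < N.+1) goodR R n <= (countN k w B)%:R.
Proof.
move=> w_ge2 w_fin NB.
pose s := [seq n <- index_iota 1 N.+1 | good n].
have -> : \sum_(1 <= n < N.+1) goodR R n = (size s)%:R.
  rewrite /goodR -natr_sum size_filter -sum1_count [in RHS]big_mkcond /=.
  by congr (_%:R); apply: eq_bigr => n _; case: good.
rewrite ler_nat; pose t := [seq 121 + shift_of n | n <- s].
have ut : uniq t.
  rewrite map_inj_in_uniq ?filter_uniq ?iota_uniq // => m n.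
  rewrite !mem_filter => /andP[gm _] /andP[gn _] /addrI; exact: shift_of_inj.
have -> : size s = #|` [fset x in t]%fset |.
  by rewrite card_fseq undup_id // size_map.
apply: fsubset_leq_card; apply/fsubsetP => x; rewrite inE => /mapP[n].
rewrite mem_filter mem_index_iota => /andP[gn /andP[_ nN]] ->.
rewrite in_fset_set; last exact: finite_countedM.
by rewrite inE; apply: (@shift_of_counted _ _ _ _ _ N).
Qed.

Theorem theorem1p6 (R : realType) (k : semiIntKind) (w : weights)
    (w_ge2 : forall i n, w i = Some n -> (2 <= n)%N)
    (w_fin : exists i, w i <> None) :
  exists c B0 : R, 0 < c /\
    forall B : R, 1 <= B -> B0 <= B ->
      c * (B / Num.sqrt (ln B)) <= (countN k w B)%:R.
Proof.
have [c [N1 [c0 hc]]] := good_count_ge R.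
(* [N] is the largest integer with [121 + 4 N <= B]. For [B >= 1000 + 4 N1] it is at least [B / 16]
   and at least [N1]. *)
exists (c / 16), (1000 + 4 * N1%:R); split; first by rewrite divr_gt0.
move=> B B1 hB; pose N := Num.truncn ((B - 121) / 4).
have N1R : 0 <= N1%:R :> R by exact: ler0n.
have hN : N%:R <= (B - 121) / 4 < N.+1%:R.
  by apply: truncn_itv; lra.
case/andP: hN => hN1; rewrite -natr1 => hN2.
have NB : 121 + 4 * N%:R <= B by lra.
have N16 : B / 16 <= N%:R by lra.
have NN1 : (N1 <= N)%N by rewrite -(ler_nat R); lra.
have N2 : (2 <= N)%N by rewrite -(ler_nat R); lra.
apply: (le_trans _ (good_sum_le_countN k w_ge2 w_fin NB)).
apply: (le_trans _ (hc N NN1)).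
have lN : 0 < ln N%:R :> R by rewrite ln_gt0 // ltr1n.
have lNB : ln N%:R <= ln B by rewrite ler_ln ?posrE ?ltr0n; [lra|lia|lra].
have sN : 0 < Num.sqrt (ln N%:R) :> R by rewrite sqrtr_gt0.
have sB : 0 < Num.sqrt (ln B) by rewrite sqrtr_gt0 (lt_le_trans lN).
rewrite -mulrA ler_pM2l // mulrA [16^-1 * B]mulrC.
apply: ler_pM; [by lra|by rewrite invr_ge0 ltW|exact: N16|].
by rewrite lef_pV2 ?posrE // ler_wsqrtr.
Qed.
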